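(* Let $k,n\in\mathbb{N}$ with $2\le k\le n$, let $m_1,\dots,m_k$ be positive integers with $\sum_{j=1}^k m_j=n$, let $(a,b)$ be an open interval, let $a<x_1<x_2<\cdots<x_k<c<d<b$, and let $p\in\mathbb{R}$. Let $f:(a,b)\times\mathbb{R}^n\to\mathbb{R}$ and consider the equation $$y^{(n)}=f\left(x,y,y',\dots,y^{(n-1)}\right),\qquad a<x<b. \qquad (E)$$ Assume: (i) $f(x,y_1,\dots,y_n)$ is continuous on $(a,b)\times\mathbb{R}^n$; (ii) for each $i=1,\dots,n$, $\frac{\partial f}{\partial y_i}(x,y_1,\dots,y_n)$ exists and is continuous on $(a,b)\times\mathbb{R}^n$; (iii) solutions of initial value problems for (E) extend to $(a,b)$; (iv) if $y,z$ are solutions of (E) on $(a,b)$ with $y^{(i)}(x_j)=z^{(i)}(x_j)$ for $0\le i\le m_j-1$, $1\le j\le k-1$, and $y^{(i)}(x_k)+\int_c^d p\,y(x)\,dx=z^{(i)}(x_k)+\int_c^d p\,z(x)\,dx$ for $0\le i\le m_k-1$, then $y\equiv z$ on $(a,b)$; (v) for every solution $y$ of (E) on $(a,b)$, if $w$ is a solution of the variational equation along $y$ with $w^{(i)}(x_j)=0$ for $0\le i\le m_j-1$, $1\le j\le k-1$, and $w^{(i)}(x_k)+\int_c^d p\,w(x)\,dx=0$ for $0\le i\le m_k-1$, then $w\equiv 0$ on $(a,b)$. Let $u(x)=u(x,x_1,\dots,x_k,y_{01},\dots,y_{m_k-1,k},p,c,d)$ be the solution of (E) on $(a,b)$ satisfying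 $$u^{(i)}(x_j)=y_{ij},\quad 0\le i\le m_j-1,\ 1\le j\le k-1,$$ $$u^{(i)}(x_k)+\int_c^d p\,u(x)\,dx=y_{ik},\quad 0\le i\le m_k-1,$$ regarded as a function of $x$ and of the boundary data (for data near the given data, in the sense described in the context). Then, with all partial derivatives taken at the given data: (a) For each $1\le l\le k-1$ and $0\le r\le m_l-1$, $Y_{rl}(x):=\frac{\partial u}{\partial y_{rl}}(x)$ exists on $(a,b)$ and is the solution of the variational equation along $u$ satisfying $Y_{rl}^{(i)}(x_j)=0$ for $0\le i\le m_j-1$, $1\le j\le k-1$, $j\ne l$; $Y_{rl}^{(i)}(x_l)=0$ for $0\le i\le m_l-1$, $i\neq r$; $Y_{rl}^{(r)}(x_l)=1$; and $Y_{rl}^{(i)}(x_k)+\int_c^d p\,Y_{rl}(x)\,dx=0$ for $0\le i\le m_k-1$. Moreover, for each $0\le r\le m_k-1$, $Y_{rk}(x):=\frac{\partial u}{\partial y_{rk}}(x)$ exists on $(a,b)$ and is the solution of the variational equation along $u$ satisfying $Y_{rk}^{(i)}(x_j)=0$ for $0\le i\le m_j-1$, $1\le j\le k-1$; $Y_{rk}^{(i)}(x_k)+\int_c^d p\,Y_{rk}(x)\,dx=0$ for $0\le i\le m_k-1$, $i\ne r$; and $Y_{rk}^{(r)}(x_k)+\int_c^d p\,Y_{rk}(x)\,dx=1$. (b) For each $1\le l\le k-1$, $X_l(x):=\frac{\partial u}{\partial x_l}(x)$ exists on $(a,b)$ and is the solution of the variational equation along $u$ satisfying $X_l^{(i)}(x_j)=0$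 for $0\le i\le m_j-1$, $1\le j\le k-1$, $j\neq l$; $X_l^{(i)}(x_l)=-u^{(i+1)}(x_l)$ for $0\le i\le m_l-1$; and $X_l^{(i)}(x_k)+\int_c^d p\,X_l(x)\,dx=0$ for $0\le i\le m_k-1$. Moreover, $X_k(x):=\frac{\partial u}{\partial x_k}(x)$ exists on $(a,b)$ and is the solution of the variational equation along $u$ satisfying $X_k^{(i)}(x_j)=0$ for $0\le i\le m_j-1$, $1\le j\le k-1$; and $X_k^{(i)}(x_k)+\int_c^d p\,X_k(x)\,dx=-u^{(i+1)}(x_k)$ for $0\le i\le m_k-1$. (c) $C(x):=\frac{\partial u}{\partial c}(x)$ exists on $(a,b)$ and is the solution of the variational equation along $u$ satisfying $C^{(i)}(x_j)=0$ for $0\le i\le m_j-1$, $1\le j\le k-1$; and $C^{(i)}(x_k)+\int_c^d p\,C(x)\,dx=p\,u(c)$ for $0\le i\le m_k-1$. (d) $D(x):=\frac{\partial u}{\partial d}(x)$ exists on $(a,b)$ and is the solution of the variational equation along $u$ satisfying $D^{(i)}(x_j)=0$ for $0\le i\le m_j-1$, $1\le j\le k-1$; and $D^{(i)}(x_k)+\int_c^d p\,D(x)\,dx=-p\,u(d)$ for $0\le i\le m_k-1$. (e) $P(x):=\frac{\partial u}{\partial p}(x)$ exists on $(a,b)$ and is the solution of the variational equation along $u$ satisfying $P^{(i)}(x_j)=0$ for $0\le i\le m_j-1$, $1\le j\le k-1$; and $P^{(i)}(x_k)+\int_c^d p\,P(x)\,dx=-\int_c^d u(x)\,dx$ for $0\le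 i\le m_k-1$.
   Context: Superscripts $(i)$ denote $i$-th derivatives with respect to $x$. Variational equation. Given a solution $y(x)$ of $y^{(n)}=f(x,y,y',\dots,y^{(n-1)})$ on $(a,b)$, the variational equation along $y(x)$ is the linear equation $$z^{(n)}=\sum_{i=1}^n\frac{\partial f}{\partial y_i}\left(x,y(x),y'(x),\dots,y^{(n-1)}(x)\right)z^{(i-1)},\qquad a<x<b.$$ Dependence of $u$ on the data. The boundary data are collected in the tuple $\lambda=(x_1,\dots,x_k,(y_{ij})_{0\le i\le m_j-1,\,1\le j\le k},p,c,d)$; let $\lambda_0$ be the given data. For $\lambda$ in some neighbourhood $N$ of $\lambda_0$, $u(\cdot,\lambda)$ denotes the solution on $(a,b)$ of the equation satisfying the boundary conditions with data $\lambda$ (that is, $u^{(i)}(x_j,\lambda)=y_{ij}$ for $0\le i\le m_j-1$, $1\le j\le k-1$, and $u^{(i)}(x_k,\lambda)+\int_c^d p\,u(x,\lambda)\,dx=y_{ik}$ for $0\le i\le m_k-1$, where $x_j,y_{ij},p,c,d$ are the entries of $\lambda$) provided by the known theorem on continuous dependence on boundary conditions: $u(\cdot,\lambda_0)=u$, and for $0\le i\le n-1$, $u^{(i)}(\cdot,\lambda)\to u^{(i)}(\cdot,\lambda_0)$ uniformly on each compact $[\alpha,\beta]\subset(a,b)$ as $\lambda\to\lambda_0$. The family $u(\cdot,\lambda)$, $\lambda\in N$, with these properties is part of the setting. A partial derivative such as $\frac{\partial u}{\partial y_{rl}}(x)$ is the derivative at $\lambda_0$ of $u(x,\lambda)$ with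 respect to that single entry of $\lambda$, all other entries being held fixed, for each $x\in(a,b)$. *)

(* Defs.v *)
From mathcomp Require Import all_boot all_order all_algebra.
From mathcomp Require Import all_classical all_reals all_analysis.

Set Implicit Arguments.
Unset Strict Implicit.
Unset Printing Implicit Defensive.

Import Order.TTheory GRing.Theory Num.Theory.
Import numFieldNormedType.Exports.

Local Open Scope ring_scope.
Local Open Scope classical_set_scope.

(* The end points of the interval (a, b) may be infinite. *)
Definition eoo (R : realType) (a b : \bar R) : set R :=
  [set x | (a < x%:E < b)%E].

Section Equation.
Context {R : realType} {n : nat}.
Implicit Types (a b : \bar R) (f : R -> 'rV[R]_n -> R) (y z : R -> R).

Definition jet y (x : R) : 'rV[R]_n := \row_(i < n) (y^`(i))%classic x.

(* y^`(i) is a total function, with an unspecified value where the derivative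
   does not exist, so that differentiability has to be required separately. *)
Definition solves a b f y := forall x, eoo a b x ->
  (forall i, (i < n)%N -> derivable y^`(i) x 1) /\ y^`(n) x = f x (jet y x).

(* Every solution on an open subinterval solves an initial value problem there
   (at any of its points), so no initial condition is mentioned. *)
Definition solutions_extend a b f := forall (al be : \bar R) y,
  (a <= al)%E -> (al < be)%E -> (be <= b)%E -> solves al be f y ->
  exists2 z, solves a b f z & forall x, eoo al be x -> z x = y x.

Definition pderiv f (i : 'I_n) (x : R) (v : 'rV[R]_n) : R :=
  'D_(delta_mx 0 i) (f x) v.

(* Right-hand side of the variational equation along y. *)
Definition variational f y : R -> 'rV[R]_n -> R :=
  fun x v => \sum_(i < n) pderiv f i x (jet y x) * v 0 i.

End Equation.

Section BoundaryData.
Context {R : realType} {k : nat} {m : 'I_k -> nat}.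

(* The tuples ((x_j)_j, (y_ij)_(i,j), p, c, d), as a product of normed spaces.
   The index j = 1, ..., k becomes j : 'I_k, so it is shifted by one. The y_ij
   form one row vector of length \sum_j m j, with y_ij at the index
   tagnat.Rank j i. *)
Definition bdata : Type := 'rV[R]_k * 'rV[R]_(\sum_(j < k) m j) * R * R * R.

Implicit Types (l : bdata) (z : R -> R).

Definition bd_x l (j : 'I_k) : R := l.1.1.1.1 0 j.
Definition bd_y l (j : 'I_k) (i : 'I_(m j)) : R :=
  l.1.1.1.2 0 (tagnat.Rank j i).
Definition bd_p l : R := l.1.1.2.
Definition bd_c l : R := l.1.2.
Definition bd_d l : R := l.2.

(* The unit vectors along which the partial derivatives at a tuple are taken. *)
Definition dir_x (j : 'I_k) : bdata := (delta_mx 0 j, 0, 0, 0, 0).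
Definition dir_y (j : 'I_k) (i : 'I_(m j)) : bdata :=
  (0, delta_mx 0 (tagnat.Rank j i), 0, 0, 0).
Definition dir_p : bdata := (0, 0, 1, 0, 0).
Definition dir_c : bdata := (0, 0, 0, 1, 0).
Definition dir_d : bdata := (0, 0, 0, 0, 1).

(* The case j.+1 = k is the one of the last point x_k. *)
Definition bop l z (j : 'I_k) (i : nat) : R :=
  (z^`(i))%classic (bd_x l j) +
  if j.+1 == k
  then \int[lebesgue_measure]_(t in `[bd_c l, bd_d l]) (bd_p l * z t)
  else 0.

Definition solves_bvp n (a b : \bar R) (g : R -> 'rV[R]_n -> R) l
    (w : forall j, 'I_(m j) -> R) z :=
  solves a b g z /\ forall j (i : 'I_(m j)), bop l z j i = w j i.

Definition unique_bvp_solution n (a b : \bar R) (g : R -> 'rV[R]_n -> R) l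
    (w : forall j, 'I_(m j) -> R) z :=
  solves_bvp a b g l w z /\
  forall z', solves_bvp a b g l w z' -> forall x, eoo a b x -> z' x = z x.

Definition solution_family n (a b : \bar R) (f : R -> 'rV[R]_n -> R)
    (l0 : bdata) (N : set bdata) (U : bdata -> R -> R) :=
  [/\ nbhs l0 N,
      forall l, N l -> solves_bvp a b f l (@bd_y l) (U l) &
      forall (i : nat) (al be : R), (i < n)%N ->
        (a < al%:E)%E -> al <= be -> (be%:E < b)%E ->
        {uniform `[al, be], (fun l => (U l)^`(i)) @ l0 --> (U l0)^`(i)}].

(* The partial derivative of U at l0 along e exists at every point of (a, b)
   and, as a function of x, it is the solution of the variational equation
   along U l0 with boundary values w. *)
Definition partial_solves n (a b : \bar R) (f : R -> 'rV[R]_n -> R)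
    (l0 : bdata) (U : bdata -> R -> R) (e : bdata)
    (w : forall j, 'I_(m j) -> R) :=
  (forall x, eoo a b x -> derivable (fun l => U l x) l0 e) /\
  unique_bvp_solution a b (variational f (U l0)) l0 w
    (fun x => 'D_e (fun l => U l x) l0).

End BoundaryData.

Arguments bdata R {k} m.

(* Main.v *)
Require Import Defs.
From mathcomp Require Import all_boot all_order all_algebra.
From mathcomp Require Import all_classical all_reals all_analysis.
From mathcomp Require Import ring lra.

(* Write u_h for the member of the family at l0 + h e and z_h for the quotient
   (u_h - u_0) / h. The mean value theorem in each coordinate of f turns the
   difference of the equations for u_h and u_0 into a linear equation for z_h,
   whose coefficients converge to those of the variational equation, while the
   boundary values of z_h converge to the prescribed ones. No existence theorem
   for differential equations is needed: divide z_h by 1 + |jet of z_h at c|.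
   By Gronwall the scaled quotients are locally bounded, so along an ultrafilter
   of parameters h they converge to a solution of the variational equation. If
   the scaling factors tended to 0, the limit would have zero boundary values,
   hence vanish by (v), although its normalisation is 1. So the factors stay
   away from 0 and z_h itself converges, to a limit that (v) makes independent
   of the ultrafilter. *)

Set Implicit Arguments.
Unset Strict Implicit.
Unset Printing Implicit Defensive.

Import Order.TTheory GRing.Theory Num.Theory.
Import numFieldNormedType.Exports.

Local Open Scope ring_scope.
Local Open Scope classical_set_scope.

(** * Extended open intervals and the mean value theorem *)

Section OpenInterval.
Context {R : realType}.
Implicit Types (a b : \bar R) (s t x : R).

Lemma eoo_near a b x : eoo a b x -> \forall y \near x, eoo a b y.
Proof.
rewrite /eoo /= => /andP[ax xb].
have : nbhs x [set y : R | (a < y%:E)%E].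
  by apply: open_nbhs_nbhs; split=> //; exact: open_ereal_gt.
have : nbhs x [set y : R | (y%:E < b)%E].
  by apply: open_nbhs_nbhs; split=> //; exact: open_ereal_lt.
apply: filterS2 => y /= yb ay; exact/andP.
Qed.

Lemma eoo_between a b s t x : eoo a b s -> eoo a b t ->
  Num.min s t <= x <= Num.max s t -> eoo a b x.
Proof.
rewrite /eoo /= => /andP[as_ sb] /andP[at_ tb] /andP[mx xM]; apply/andP; split.
  apply: (@lt_le_trans _ _ (Num.min s t)%:E); last by rewrite lee_fin.
  by rewrite /Num.min; case: ifP.
apply: (@le_lt_trans _ _ (Num.max s t)%:E); first by rewrite lee_fin.
by rewrite /Num.max; case: ifP.
Qed.

Lemma between_dist s t x :
  Num.min s t <= x <= Num.max s t -> `|s - x| <= `|s - t|.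
Proof.
have [st|ts] := leP s t => /andP[sx xt].
  by rewrite !ler0_norm; lra.
by rewrite !ger0_norm; lra.
Qed.

(** The end points are unordered because the increments met later can have either sign; the case
    [t <= s] follows by exchanging them. *)
Lemma MVT_between (f df : R -> R) s t :
  (forall x, Num.min s t <= x <= Num.max s t -> is_derive x 1 f (df x)) ->
  exists2 c, Num.min s t <= c <= Num.max s t & f t - f s = df c * (t - s).
Proof.
wlog st : s t / s <= t => [W|] dfx.
  have /orP[/W|ts] := le_total s t; first exact.
  have [x xst] : exists2 c, Num.min t s <= c <= Num.max t s &
      f s - f t = df c * (s - t).
    by apply: W => // x; rewrite minC maxC; exact: dfx.
  rewrite minC maxC in xst => e; exists x => //.
  by rewrite -opprB e -mulrN opprB.
have xE x : Num.min s t <= x <= Num.max s t = (x \in `[s, t]%R).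
  by rewrite in_itv /= (min_idPl st) (max_idPr st).
have [||c cst ->] := @MVT_segment R f df s t st.
- move=> x xst; apply: dfx; rewrite xE; exact: subset_itv_oo_cc.
- apply: derivable_within_continuous => x xst.
  by have := dfx x; rewrite xE => /(_ xst) [].
by exists c => //; rewrite xE.
Qed.

End OpenInterval.

(** * Locally uniform limits of functions and of their derivatives *)

(* Convergence of q h t to l x along filter_prod F (nbhs x), for every x of an
   interval, is locally uniform convergence of q h to a continuous l; unlike the
   latter it passes through sums, products and compositions at a single point. *)
Section JointConvergence.
Context {R : realType} {T : Type} (F : set_system T) {FF : ProperFilter F}.
Implicit Types (g q : T -> R -> R) (x : R).

(** A single radius serves all [h] in a set of the filter, so the mean value theorem can be used on
    every segment from [x] to [t] inside that radius. *)
Lemma joint_nearP (P : T -> R -> Prop) x :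
  (\forall ht \near filter_prod F (nbhs x), P ht.1 ht.2) <->
  exists2 e : R, 0 < e & \forall h \near F, forall t, `|x - t| < e -> P h t.
Proof.
split=> [[[A B] /= [FA /nbhs_ballP[e /= e0 eB]] AB]|[e e0 FP]].
  exists e => //; apply: filterS FA => h Ah t /eB Bt.
  exact: (AB (h, t)).
exists ([set h | forall t, `|x - t| < e -> P h t], ball x e).
  by split=> //=; exact: nbhsx_ballx.
by move=> [h t] /= [+ xt]; exact.
Qed.

Lemma joint_near_snd (P : R -> Prop) x :
  (\forall t \near x, P t) -> \forall ht \near filter_prod F (nbhs x), P ht.2.
Proof.
move=> /nbhs_ballP[e /= e0 xP]; apply/(joint_nearP (fun=> P)).
by exists e => //; apply: filterE => h t; exact: xP.
Qed.

Lemma joint_cvg_pt q x (l : R) :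
  q ht.1 ht.2 @[ht --> filter_prod F (nbhs x)] --> l -> q h x @[h --> F] --> l.
Proof.
move=> ql; apply: cvg_trans ql => A; rewrite !nbhs_filterE /fmap /=.
move/(joint_nearP (fun h t => A (q h t))) => [e e0]; apply: filterS => h; apply.
by rewrite subrr normr0.
Qed.

(** By the mean value theorem a difference quotient of [g k] at [x] is a value of [q k], hence
    within [e] of [l] once the step is below a radius independent of [k]. Letting [k] follow [F] at
    a fixed step gives the same bound for [g0]. *)
Lemma is_derive_limit g q (g0 : R -> R) (x l : R) :
  (\forall ht \near filter_prod F (nbhs x),
     is_derive (ht.2 : R) 1 (g ht.1) (q ht.1 ht.2)) ->
  (\forall y \near x, g h y @[h --> F] --> g0 y) ->
  q ht.1 ht.2 @[ht --> filter_prod F (nbhs x)] --> l ->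
  is_derive x 1 g0 l.
Proof.
move=> dg gg0 ql.
have g0x := nbhs_singleton gg0.
suff H : h^-1 *: ((g0 \o shift x) (h *: 1) - g0 x) @[h --> 0^'] --> l.
  by apply: DeriveDef; [apply/cvg_ex; exists l|apply/cvg_lim].
apply/cvgrPdist_le => e e0.
have /(joint_nearP (fun h t => is_derive t 1 (g h) (q h t) /\
    `|l - q h t| <= e))[d d0 Fd] : \forall ht \near filter_prod F (nbhs x),
    is_derive (ht.2 : R) 1 (g ht.1) (q ht.1 ht.2) /\ `|l - q ht.1 ht.2| <= e.
  by apply: filterS2 dg ((cvgrPdist_le _ _).1 ql e e0) => ht; split.
have g0d : \forall h \near 0^', g k (h + x) @[k --> F] --> g0 (h + x).
  apply: cvg_within; have := gg0; rewrite (near_shift 0 x) /=.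
  by apply: filterS => y; rewrite /= subr0.
near=> h.
have h0 : h != 0 by near: h; exact: nbhs_dnbhs_neq.
have hd : `|h| < d by near: h; exact: dnbhs0_lt.
rewrite /= [h *: 1]mulr1.
have gh : g k (h + x) @[k --> F] --> g0 (h + x) by near: h.
(* Without the denominator this is a non-strict inequality that passes to the limit in [k]
   directly. *)
suff : `|l * h - (g0 (h + x) - g0 x)| <= e * `|h|.
  have -> : l - h^-1 *: (g0 (h + x) - g0 x) =
      h^-1 * (l * h - (g0 (h + x) - g0 x)).
    by rewrite mulrBr mulrCA mulVf// mulr1.
  by rewrite normrM normfV ler_pdivrMl ?normr_gt0// [in leRHS]mulrC.
have cv : `|l * h - (g k (h + x) - g k x)| @[k --> F] -->
    `|l * h - (g0 (h + x) - g0 x)|.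
  by apply: cvg_norm; apply: cvgB; [exact: cvg_cst|exact: cvgB].
apply: (cvgr_to_le cv).
apply: filterS Fd => k Fk.
have dist c : Num.min x (h + x) <= c <= Num.max x (h + x) -> `|x - c| < d.
  move=> /between_dist/le_lt_trans; apply.
  by rewrite opprD addrCA subrr addr0 normrN.
have [c cx ->] : exists2 c, Num.min x (h + x) <= c <= Num.max x (h + x) &
    g k (h + x) - g k x = q k c * (h + x - x).
  by apply: MVT_between => c /dist/Fk[].
rewrite addrK -mulrBl normrM ler_wpM2r//.
by have [] := Fk c (dist c cx).
Unshelve. all: by end_near. Qed.

(** The bound on the derivatives makes the functions [g h] Lipschitz near [x] with a common
    constant, so convergence at the single point [x] spreads to joint convergence. *)
Lemma joint_cvg_lip g q (x M l : R) :
  (\forall ht \near filter_prod F (nbhs x),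
     is_derive (ht.2 : R) 1 (g ht.1) (q ht.1 ht.2) /\ `|q ht.1 ht.2| <= M) ->
  g h x @[h --> F] --> l ->
  g ht.1 ht.2 @[ht --> filter_prod F (nbhs x)] --> l.
Proof.
move=> /(joint_nearP (fun h t => is_derive t 1 (g h) (q h t) /\
  `|q h t| <= M))[d d0 Fd] gl; apply/cvgrPdist_lt => e e0.
apply/(joint_nearP (fun h t => `|l - g h t| < e)).
(* A positive bound is required for the division below, whatever the sign of [M]. *)
pose M1 := `|M| + 1.
have M10 : 0 < M1 by rewrite ltr_wpDl.
exists (Num.min d (e / 2 / M1)).
  by rewrite lt_min d0 /= !divr_gt0.
apply: filterS2 Fd ((cvgrPdist_lt _ _).1 gl (e / 2) _) => [h Fh glh t|].
  rewrite lt_min => /andP[xd xM].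
  have dist c : Num.min x t <= c <= Num.max x t -> `|x - c| < d.
    by move=> /between_dist/le_lt_trans; exact.
  have [c cx gE] : exists2 c, Num.min x t <= c <= Num.max x t &
      g h t - g h x = q h c * (t - x).
    by apply: MVT_between => c /dist/Fh[].
  have [_ qM] := Fh c (dist c cx).
  have : `|g h t - g h x| < e / 2.
    rewrite gE normrM (distrC t x).
    apply: (@le_lt_trans _ _ (M1 * `|x - t|)).
      by rewrite ler_wpM2r// (le_trans qM)// (le_trans (ler_norm _))// lerDl.
    by rewrite mulrC -ltr_pdivlMr.
  have -> : l - g h t = (l - g h x) - (g h t - g h x) by lra.
  move=> gt; rewrite (le_lt_trans (ler_normB _ _))//; lra.
by rewrite divr_gt0.
Qed.

End JointConvergence.

(** * Limits along ultrafilters *)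

Section Ultrafilter.
Context {T : Type}.

Lemma ultra_fmap (U : Type) (F : set_system T) (f : T -> U) :
  UltraFilter F -> UltraFilter (f @ F).
Proof.
move=> FU; split=> [|G GG FG]; first exact: fmap_proper_filter.
apply/seteqP; split=> [A GA|]; last exact: FG.
have [//|FnA] := in_ultra_setVsetC (f @^-1` A) FU.
have /FG GnA : (f @ F) (~` A) by [].
by have [? []] := filter_ex (filterI GA GnA).
Qed.

Lemma ultra_bounded_cvg {R : realType} (F : set_system T) (g : T -> R) M :
  UltraFilter F -> (\forall h \near F, `|g h| <= M) -> cvg (g h @[h --> F]).
Proof.
move=> FU FM; have := @segment_compact R (- M) M.
rewrite compact_ultra => /(_ _ (ultra_fmap g FU)) [].
  by apply: filterS FM => h; rewrite /= in_itv /= ler_norml.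
by move=> l [_ gl]; apply/cvg_ex; exists l.
Qed.

(** If the preimage of a neighbourhood of [l] were not in [F], restricting [F] to its complement
    would give a proper filter. An ultrafilter above that would contain both the preimage and the
    complement. *)
Lemma ultra_cvg (V : topologicalType) (F : set_system T) (g : T -> V) (l : V) :
  ProperFilter F ->
  (forall G, UltraFilter G -> F `<=` G -> g h @[h --> G] --> l) ->
  g h @[h --> F] --> l.
Proof.
move=> FF H A lA; apply: contrapT => nFA.
pose B := g @^-1` A.
have FB : ProperFilter (within (~` B) F).
  split; last exact: within_filter.
  by rewrite /within /= => F0; apply: nFA; apply: filterS F0 => h; apply: contrapT.
have [G [GU FG]] := ultraFilterLemma FB.
have GB : G B.
  apply: (H G GU _ A lA) => C FC; apply: FG.
  by rewrite /within /=; apply: filterS FC.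
have GnB : G (~` B) by apply: FG; rewrite /within /=; apply: filterE.
by have [? []] := filter_ex (filterI GB GnB).
Qed.

End Ultrafilter.

(** * Gronwall's inequality and the energy estimate *)

Section Gronwall.
Context {R : realType}.

(** The function [E x * expR (- k * (x - s))] does not increase on the way from [s] to [t]. Giving
    [k] the sign of [t - s] treats both directions at once and turns [k * (t - s)] into
    [K * |t - s|]. *)
Lemma gronwall (E dE : R -> R) (K s t : R) :
  (forall x, Num.min s t <= x <= Num.max s t ->
     is_derive x 1 E (dE x) /\ `|dE x| <= K * E x) ->
  E t <= E s * expR (K * `|t - s|).
Proof.
move=> dEK; pose k := K * Num.sg (t - s).
pose G (x : R) := E x * expR (- k * (x - s)).
pose dG (x : R) := (dE x - k * E x) * expR (- k * (x - s)).
have dGE x : Num.min s t <= x <= Num.max s t -> is_derive x 1 G (dG x).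
  move=> /dEK[dEx _].
  have dk : is_derive x 1 (fun y : R => - k * (y - s)) (- k).
    have -> : (fun y : R => - k * (y - s)) = (- k) \*: (id - cst s).
      by apply/funext.
    by apply: is_derive_eq; rewrite subr0 scaler1.
  have de := @is_derive1_comp R expR (fun y : R => - k * (y - s)) x _ _
    (is_derive_expR _) dk.
  apply: is_derive_eq (is_deriveM dEx de) _.
  by rewrite /dG /GRing.scale /=; ring.
have [c cst GE] := MVT_between dGE.
have {}GE : G t - G s <= 0.
  rewrite GE /dG mulrAC pmulr_lle0 ?expR_gt0//.
  have [_] := dEK _ cst; rewrite ler_norml => /andP[lo up].
  by rewrite /k; case: (sgrP (t - s)) => ts; nra.
move: GE; rewrite /G subrr mulr0 expR0 mulr1 mulNr expRN.
by rewrite subr_le0 ler_pdivrMr ?expR_gt0// /k normrEsg mulrA.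
Qed.

(** The left-hand sum is the derivative of the energy, the sum of the squares, when [V i.+1] is the
    derivative of [V i]. Products of two entries below [n] are at most the energy; only the last
    summand involves [V n], and there the assumed bound yields [n%:R * L] times the energy. Each of
    the [n] summands thus satisfies one common bound. *)
Lemma energy_bound n (V : nat -> R) (L : R) : 0 <= L ->
  `|V n| <= L * \sum_(i < n) `|V i| ->
  `|\sum_(i < n) (V i * V i.+1) *+ 2| <=
    (n%:R * (2 + n%:R * L * 2)) * \sum_(i < n) V i ^+ 2.
Proof.
move=> L0 VL; set E := \sum_(i < n) V i ^+ 2.
have E0 : 0 <= E by apply: sumr_ge0 => i _; rewrite sqr_ge0.
have VE (k : nat) : (k < n)%N -> `|V k| ^+ 2 <= E.
  move=> kn; rewrite /E (bigD1 (Ordinal kn)) //= real_normK ?num_real//.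
  by rewrite lerDl sumr_ge0// => i _; rewrite sqr_ge0.
have VV (k l : nat) : (k < n)%N -> (l < n)%N -> `|V k| * `|V l| <= E.
  move=> /VE kE /VE lE; have := sqr_ge0 (`|V k| - `|V l|); lra.
apply: (le_trans (ler_norm_sum _ _ _)).
rewrite -mulrA.
rewrite [leRHS](_ : _ = \sum_(i < n) ((2 + n%:R * L * 2) * E)); last first.
  by rewrite sumr_const card_ord mulr_natl.
apply: ler_sum => i _; rewrite normrMn normrM.
have nL : 0 <= n%:R * L * E by rewrite !mulr_ge0.
have := ltn_ord i; rewrite leq_eqVlt => /predU1P[iE|/(VV i _ (ltn_ord i))]; last lra.
suff : `|V i| * `|V i.+1| <= n%:R * L * E by lra.
rewrite iE; apply: (@le_trans _ _ (`|V i| * (L * \sum_(i < n) `|V i|))).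
  by rewrite ler_wpM2l.
rewrite mulrCA [n%:R * L]mulrC -mulrA ler_wpM2l// mulr_sumr.
rewrite [leRHS](_ : _ = \sum_(i < n) E); last by rewrite sumr_const card_ord mulr_natl.
by apply: ler_sum => k _; exact: VV.
Qed.

End Gronwall.

(** * Functions together with their successive derivatives *)

Section Chain.
Context {R : realType}.
Implicit Types (a b : \bar R) (y : R -> R) (Z : nat -> R -> R).

(** The derivatives are listed as separate functions constrained only on (a, b), so that linear
    combinations and limits can be formed entry by entry. The iterated derivatives are recovered by
    [chain_derive1n]. *)
Definition derivative_chain a b n Z := forall i, (i < n)%N ->
  forall x, eoo a b x -> is_derive x 1 (Z i) (Z i.+1 x).

Lemma chain_derive1n a b n Z y : derivative_chain a b n Z ->
  (forall x, eoo a b x -> y x = Z 0 x) ->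
  forall i, (i <= n)%N -> forall x, eoo a b x -> (y^`(i))%classic x = Z i x.
Proof.
move=> cZ yZ; elim=> [|i IH] ni x abx; first exact: yZ.
rewrite derive1nS derive1E.
have [_ <-] := cZ i ni x abx; apply: near_eq_derive.
by apply: filterS (eoo_near abx) => t; apply: IH; exact: ltnW.
Qed.

Lemma chain_derivable a b n Z y : derivative_chain a b n Z ->
  (forall x, eoo a b x -> y x = Z 0 x) ->
  forall i, (i < n)%N -> forall x, eoo a b x -> derivable y^`(i) x 1.
Proof.
move=> cZ yZ i ni x abx; have [d _] := cZ i ni x abx.
apply: near_eq_derivable d; apply: filterS (eoo_near abx) => t abt.
by rewrite (chain_derive1n cZ yZ) // ltnW.
Qed.

Lemma chain_solves a b n (g : R -> 'rV[R]_n -> R) Z y :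
  derivative_chain a b n Z -> (forall x, eoo a b x -> y x = Z 0 x) ->
  (forall x, eoo a b x -> Z n x = g x (\row_(i < n) Z i x)) ->
  solves a b g y.
Proof.
move=> cZ yZ Zn x abx; split; first by move=> i ni; exact: (chain_derivable cZ yZ).
rewrite (chain_derive1n cZ yZ) // Zn //; congr (g x _); apply/rowP => i.
by rewrite !mxE (chain_derive1n cZ yZ) // ltnW.
Qed.

Lemma solves_chain a b n (g : R -> 'rV[R]_n -> R) y :
  solves a b g y -> derivative_chain a b n (fun i => (y^`(i))%classic).
Proof.
move=> sy i ni x /sy[/(_ _ ni) d _]; apply: DeriveDef => //.
by rewrite derive1nS derive1E.
Qed.

Lemma chain_continuous a b n Z i x : derivative_chain a b n Z -> (i < n)%N ->
  eoo a b x -> {for x, continuous (Z i)}.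
Proof.
move=> cZ ni abx; have [d _] := cZ i ni x abx.
by apply: differentiable_continuous; apply/derivable1_diffP.
Qed.

(** Gronwall's inequality for the energy of the chain, which, unlike a sum of absolute values, is
    differentiable. *)
Lemma chain_bound a b n Z (L x t : R) : derivative_chain a b n Z ->
  eoo a b x -> eoo a b t -> 0 <= L ->
  (forall s, Num.min x t <= s <= Num.max x t ->
     `|Z n s| <= L * (\sum_(i < n) `|Z i s|)) ->
  \sum_(i < n) Z i t ^+ 2 <=
    (\sum_(i < n) Z i x ^+ 2) * expR (n%:R * (2 + n%:R * L * 2) * `|t - x|).
Proof.
move=> cZ abx abt L0 ZL.
apply: (@gronwall R (fun s => \sum_(i < n) Z i s ^+ 2)
  (fun s => \sum_(i < n) (Z i s * Z i.+1 s) *+ 2)) => s xst; split.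
  have abs := eoo_between abx abt xst.
  have -> : (fun s => \sum_(i < n) Z i s ^+ 2) = \sum_(i < n) (Z i ^+ 2).
    by apply/funext => r; rewrite fct_sumE.
  apply: is_derive_sum => i.
  have dZ := cZ i (ltn_ord i) s abs.
  by apply: is_derive_eq; rewrite /GRing.scale /= expr1 -mulrA mulr_natl.
exact: (@energy_bound R n (fun i => Z i s) L L0 (ZL s xst)).
Qed.

End Chain.

(** * From local to uniform statements on compact sets *)

Section CompactJoint.
Context {R : realType}.

Lemma compact_joint_near (T : Type) (F : set_system T) {FF : ProperFilter F}
    (K : set R) (P : T -> R -> Prop) :
  compact K ->
  (forall x, K x -> \forall ht \near filter_prod F (nbhs x), P ht.1 ht.2) ->
  \forall h \near F, forall t, K t -> P h t.
Proof.
move=> /compact_near_coveringP cK KP; apply: cK => x /KP.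
move=> [[A B] /= [FA xB] AB]; exists (B, A) => //= -[t h] /= [Bt Ah].
exact: (AB (h, t)).
Qed.

(** The bound [L] is treated as a further parameter tending to infinity, so one covering argument
    chooses it together with the range of [h]. Having the conclusion for all large [L] lets finitely
    many coefficients share one bound. *)
Lemma compact_joint_bounded (T : Type) (F : set_system T) {FF : ProperFilter F}
    (K : set R) (q : T -> R -> R) (l : R -> R) :
  compact K ->
  (forall x, K x -> q ht.1 ht.2 @[ht --> filter_prod F (nbhs x)] --> l x) ->
  \forall L \near +oo, \forall h \near F, forall t, K t -> `|q h t| <= L.
Proof.
move=> cK ql.
have : \forall hL \near filter_prod F (pinfty_nbhs R), forall t, K t -> `|q hL.1 t| <= hL.2.
  apply: (@compact_joint_near _ _ _ K (fun hL t => `|q hL.1 t| <= hL.2)) => // x /ql.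
  move=> /cvgrPdist_lt/(_ 1 ltr01)/(joint_nearP (fun h t => `|l x - q h t| < 1)).
  move=> [e e0 Fe].
  apply/(joint_nearP (fun hL t => `|q hL.1 t| <= hL.2)); exists e => //.
  exists ([set h | forall t, `|x - t| < e -> `|l x - q h t| < 1],
    [set L | `|l x| + 1 < L]); first by split=> //=; exact: nbhs_pinfty_gt.
  move=> [h L] /= [ht lL] t /ht qt.
  have := ler_normD (l x) (q h t - l x).
  by rewrite addrC subrK -(distrC (l x)); lra.
move=> [[A B] /= [FA FB] AB]; apply: filterS FB => L BL.
by apply: filterS FA => h Ah t Kt; exact: (AB (h, L)).
Qed.

End CompactJoint.

(** * Ultralimits of solutions of linear equations with converging coefficients *)

Section LinearLimit.
Context {R : realType} {T : Type} (F : set_system T) {FF : UltraFilter F}.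
Variables (a b : \bar R) (n : nat) (v : T -> nat -> R -> R).
Variables (A : T -> 'I_n -> R -> R) (A0 : 'I_n -> R -> R) (x0 M : R).
Hypothesis abx0 : eoo a b x0.
Hypothesis v_chain : \forall h \near F, derivative_chain a b n (v h).
Hypothesis v_top : \forall h \near F, forall x, eoo a b x ->
  v h n x = \sum_(i < n) A h i x * v h i x.
Hypothesis A_cvg : forall i x, eoo a b x ->
  A ht.1 i ht.2 @[ht --> filter_prod F (nbhs x)] --> A0 i x.
Hypothesis v_bounded : forall i : 'I_n, \forall h \near F, `|v h i x0| <= M.

(** The coefficients are eventually bounded on a compact segment containing [x0] and a neighbourhood
    of [x]. The energy estimate carries the bound at [x0] across that segment, and the equation then
    bounds the entry of index [n]. *)
Lemma chain_locally_bounded x : eoo a b x -> exists B, 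
  \forall ht \near filter_prod F (nbhs x), forall i, (i <= n)%N ->
    `|v ht.1 i ht.2| <= B.
Proof.
move=> abx; have /nbhs_ballP[d /= d0 dab] := eoo_near abx.
pose e := d / 2; have e0 : 0 < e by rewrite divr_gt0.
have abe (s : R) : `|x - s| <= e -> eoo a b s.
  by move=> xs; apply: dab; rewrite /ball /= /e; move: xs; rewrite /e; lra.
(* The smallest segment containing [x0] and the closed neighbourhood of [x] of radius [e]; halving
   [d] keeps it inside (a, b). *)
pose al := Num.min x0 (x - e); pose be := Num.max x0 (x + e).
have abal : eoo a b al.
  by rewrite /al /Num.min; case: ifP => // _; apply: abe; rewrite opprB addrC subrK gtr0_norm.
have abbe : eoo a b be.
  rewrite /be /Num.max; case: ifP => // _; apply: abe.
  by rewrite opprD addrA subrr sub0r normrN gtr0_norm.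
have albe : al <= be by rewrite /al /be ge_min le_max lexx.
have abK s : s \in `[al, be]%R -> eoo a b s.
  rewrite in_itv /= => sab; apply: (eoo_between abal abbe).
  by rewrite (min_idPl albe) (max_idPr albe).
have [L [L0 FL]] : exists L : R, 0 <= L /\ \forall h \near F, forall (i : 'I_n) t,
    `[al, be] t -> `|A h i t| <= L.
  have : \forall L \near +oo, forall i, \forall h \near F, forall t, `[al, be] t ->
      `|A h i t| <= L.
    apply: filter_forall => i; apply: (compact_joint_bounded (l := A0 i)).
      exact: segment_compact.
    by move=> s sK; apply: A_cvg; exact: abK.
  move=> /(filterI (nbhs_pinfty_ge (num_real 0)))/filter_ex[L [L0 H]].
  by exists L; split=> //; exact: filter_forall.
(* The energy at [x0] is at most [n%:R * M ^+ 2], and [be - al] is the greatest distance that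
   Gronwall has to cover. *)
pose C := n%:R * M ^+ 2 *
  expR (n%:R * (2 + n%:R * L * 2) * (be - al)).
(* A square at most [C] forces an absolute value at most [C + 1], which avoids a square root. *)
pose B := C + 1.
have M0 : n%:R * M ^+ 2 >= 0 :> R by rewrite mulr_ge0 ?sqr_ge0.
have C0 : 0 <= C by rewrite mulr_ge0// expR_ge0.
exists (B + L * (n%:R * B)).
apply/(joint_nearP (fun h t => forall i, (i <= n)%N ->
  `|v h i t| <= B + L * (n%:R * B))).
exists e => //.
have Fb := filter_forall _ v_bounded.
near=> h => t xt.
have chn : derivative_chain a b n (v h) by near: h.
have top : forall s, eoo a b s ->
  v h n s = \sum_(i < n) A h i s * v h i s by near: h.
have hL : forall (i : 'I_n) t, `[al, be] t -> `|A h i t| <= L by near: h.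
have hb : forall i : 'I_n, `|v h i x0| <= M by near: h; exact: Fb.
have abt : eoo a b t by apply: abe; exact: ltW.
have topL s : s \in `[al, be]%R -> `|v h n s| <= L * (\sum_(i < n) `|v h i s|).
  move=> sK; rewrite top; last exact: abK.
  rewrite mulr_sumr (le_trans (ler_norm_sum _ _ _))//; apply: ler_sum => i _.
  by rewrite normrM ler_wpM2r// hL.
have x0tK s : Num.min x0 t <= s <= Num.max x0 t -> s \in `[al, be]%R.
  rewrite in_itv /= /al /be => /andP[ms sM]; apply/andP; split.
    apply: le_trans ms; rewrite le_min !ge_min lexx /=; apply/orP; right.
    by move: xt; rewrite ltr_norml; lra.
  apply: (le_trans sM); rewrite ge_max !le_max lexx /=; apply/orP; right.
  by move: xt; rewrite ltr_norml; lra.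
have tK : t \in `[al, be]%R by apply: x0tK; rewrite ge_min le_max lexx !orbT.
have x0K : x0 \in `[al, be]%R by apply: x0tK; rewrite ge_min le_max lexx.
have vC : \sum_(i < n) v h i t ^+ 2 <= C.
  apply: (le_trans (chain_bound chn abx0 abt L0 (fun s xs => topL s (x0tK s xs)))).
  apply: ler_pM.
  - by apply: sumr_ge0 => i _; rewrite sqr_ge0.
  - exact: expR_ge0.
  - rewrite mulr_natl -[in leRHS](card_ord n) -sumr_const; apply: ler_sum => i _.
    by rewrite -real_normK ?num_real// lerXn2r// ?nnegrE// (le_trans _ (hb i)).
  - rewrite ler_expR ler_wpM2l//.
      by rewrite !mulr_ge0// addr_ge0// !mulr_ge0.
    by move: tK x0K; rewrite !in_itv /= ler_norml; lra.
have vB (i : 'I_n) : `|v h i t| <= B.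
  have : `|v h i t| ^+ 2 <= C.
    apply: le_trans vC; rewrite (bigD1 i) //= real_normK ?num_real// lerDl.
    by rewrite sumr_ge0// => j _; rewrite sqr_ge0.
  have := sqr_ge0 (`|v h i t| - 1); rewrite /B.
  by have := normr_ge0 (v h i t); nra.
have B0 : 0 <= B by rewrite addr_ge0.
have LB0 : 0 <= L * (n%:R * B) by rewrite !mulr_ge0.
move=> i; rewrite leq_eqVlt => /predU1P[->|ni]; last first.
  by rewrite (le_trans (vB (Ordinal ni)))// lerDl.
rewrite (le_trans (topL t tK))// ler_wpDl// ler_wpM2l//.
rewrite mulr_natl -[in leRHS](card_ord n) -sumr_const; exact: ler_sum.
Unshelve. all: by end_near. Qed.

(** Local bounds give pointwise limits along the ultrafilter, which replaces the extraction of a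
    subsequence in the Arzelà-Ascoli theorem. Since each entry below [n] has the next one, which is
    bounded, as its derivative, its convergence is joint, and [is_derive_limit] makes the limits a
    chain. *)
Lemma chain_ultralimit : exists V : nat -> R -> R,
  [/\ derivative_chain a b n V,
      forall x, eoo a b x -> V n x = \sum_(i < n) A0 i x * V i x &
      forall i x, (i <= n)%N -> eoo a b x ->
        v ht.1 i ht.2 @[ht --> filter_prod F (nbhs x)] --> V i x].
Proof.
pose V i (x : R) := lim (v h i x @[h --> F]).
have vV i x : (i <= n)%N -> eoo a b x -> v h i x @[h --> F] --> V i x.
  move=> ni /chain_locally_bounded[B].
  move=> /(joint_nearP (fun h t => forall i, (i <= n)%N -> `|v h i t| <= B)).
  move=> [e e0 FB]; apply: (ultra_bounded_cvg (M := B) FF).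
  by apply: filterS FB => h /(_ x); rewrite subrr normr0; exact.
have dv i x : (i < n)%N -> eoo a b x ->
    \forall ht \near filter_prod F (nbhs x),
      is_derive (ht.2 : R) 1 (v ht.1 i) (v ht.1 i.+1 ht.2).
  move=> ni abx; exists ([set h | derivative_chain a b n (v h)], eoo a b).
    by split => //=; exact: eoo_near.
  by move=> [h t] /= [ch abt]; exact: ch.
have jV i x : (i < n)%N -> eoo a b x ->
    v ht.1 i ht.2 @[ht --> filter_prod F (nbhs x)] --> V i x.
  move=> ni abx; have [B FB] := chain_locally_bounded abx.
  apply: (joint_cvg_lip (g := fun h => v h i) (q := fun h => v h i.+1) (M := B)).
    by apply: filterS2 FB (dv i x ni abx) => ht /(_ _ ni); split.
  by apply: vV => //; exact: ltnW.
(* No derivative of the entry of index [n] is controlled, so its joint limit is obtained from the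
   equation. *)
have jn x : eoo a b x -> v ht.1 n ht.2 @[ht --> filter_prod F (nbhs x)] -->
    \sum_(i < n) A0 i x * V i x.
  move=> abx.
  have : \sum_(i < n) A ht.1 i ht.2 * v ht.1 i ht.2
      @[ht --> filter_prod F (nbhs x)] --> \sum_(i < n) A0 i x * V i x.
    apply: cvg_big => [|i _]; first exact: add_continuous.
    by apply: cvgM; [exact: A_cvg|exact: jV].
  apply: cvg_trans; apply: near_eq_cvg.
  exists ([set h | forall x, eoo a b x ->
    v h n x = \sum_(i < n) A h i x * v h i x], eoo a b).
    by split => //=; exact: eoo_near.
  by move=> [h t] /= [ch abt]; rewrite ch.
have Vn x : eoo a b x -> V n x = \sum_(i < n) A0 i x * V i x.
  by move=> abx; apply/cvg_lim => //; exact: (joint_cvg_pt (q := fun h => v h n) (jn x abx)).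
have j i x : (i <= n)%N -> eoo a b x ->
    v ht.1 i ht.2 @[ht --> filter_prod F (nbhs x)] --> V i x.
  by rewrite leq_eqVlt => /predU1P[-> abx|]; [rewrite Vn//; exact: jn|exact: jV].
exists V; split=> // i ni x abx.
apply: (is_derive_limit (g := fun h => v h i) (q := fun h => v h i.+1)
  (dv i x ni abx)); last exact: j.
by apply: filterS (eoo_near abx) => t abt; apply: vV => //; exact: ltnW.
Qed.

End LinearLimit.

(** * Integrals with varying end points and integrands *)

Section Integral.
Context {R : realType} (a b : \bar R).
Implicit Types (q : R -> R) (s t x : R).
Local Notation mu := (@lebesgue_measure R).

Lemma eoo_itv s t x : eoo a b s -> eoo a b t -> x \in `[s, t]%R -> eoo a b x.
Proof.
move=> abs abt; rewrite in_itv /= => /andP[sx xt].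
apply: (eoo_between abs abt).
by rewrite (min_idPl (le_trans sx xt)) (max_idPr (le_trans sx xt)) sx.
Qed.

Lemma eoo_integrable q s t : (forall x, eoo a b x -> {for x, continuous q}) ->
  eoo a b s -> eoo a b t -> mu.-integrable `[s, t] (EFin \o q).
Proof.
move=> cq abs abt; apply: continuous_compact_integrable.
  exact: segment_compact.
apply: continuous_in_subspaceT => x; rewrite inE /= => xst.
by apply: cq; exact: (eoo_itv abs abt).
Qed.

Lemma is_derive_integral q s x : (forall x, eoo a b x -> {for x, continuous q}) ->
  eoo a b s -> eoo a b x -> s < x ->
  is_derive x 1 (fun y => \int[mu]_(t in `[s, y]) q t) (q x).
Proof.
move=> cq abs abx sx.
have /nbhs_ballP[e /= e0 eab] := eoo_near abx.
(* The fundamental theorem is applied on a segment reaching beyond [x], so that [x] is an interior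
   point. *)
have abu : eoo a b (x + e / 2).
  apply: eab; rewrite /ball /= opprD addrA subrr sub0r normrN gtr0_norm ?divr_gt0//.
  by rewrite ltr_pdivrMr// ltr_pMr// ltr1n.
have xu : x < x + e / 2 by rewrite ltrDl divr_gt0.
have [d dE] := continuous_FTC1_closed xu (eoo_integrable cq abs abu) sx (cq x abx).
by apply: DeriveDef => //; rewrite -derive1E.
Qed.

(** Replaces a moving lower end point by a moving upper one, the case treated by
    [is_derive_integral]. *)
Lemma integral_diff q s t x : (forall x, eoo a b x -> {for x, continuous q}) ->
  eoo a b s -> eoo a b t -> s <= x -> x <= t ->
  \int[mu]_(y in `[x, t]) q y =
  \int[mu]_(y in `[s, t]) q y - \int[mu]_(y in `[s, x]) q y.
Proof.
move=> cq abs abt sx xt.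
have abx : eoo a b x by apply: (eoo_itv abs abt); rewrite in_itv /= sx.
rewrite (Rintegral_itvB (eoo_integrable cq abs abt)) ?bnd_simp//.
rewrite Rintegral_itv_obnd_cbnd//.
by apply: integrableS (eoo_integrable cq abx abt) => //; exact: subset_itv_oc_cc.
Qed.

(** Joint convergence is uniform on the compact segment from [c] to [d], so the integrals converge
    as well. *)
Lemma integral_joint_cvg (T : Type) (F : set_system T) {FF : ProperFilter F}
    (q : T -> R -> R) (q0 : R -> R) c d :
  eoo a b c -> eoo a b d -> c <= d ->
  (\forall h \near F, forall x, eoo a b x -> {for x, continuous (q h)}) ->
  (forall x, eoo a b x -> {for x, continuous q0}) ->
  (forall x, eoo a b x ->
     q ht.1 ht.2 @[ht --> filter_prod F (nbhs x)] --> q0 x) ->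
  \int[mu]_(t in `[c, d]) q h t @[h --> F] --> \int[mu]_(t in `[c, d]) q0 t.
Proof.
move=> abc abd cd cq cq0 qq0; apply/cvgrPdist_le => e e0.
(* The added 1 keeps the divisor positive when [c = d]. *)
pose e1 := e / (d - c + 1).
have dc : 0 < d - c + 1 by lra.
have e10 : 0 < e1 by rewrite divr_gt0.
have : \forall h \near F, forall t, `[c, d] t -> `|q0 t - q h t| <= e1.
  apply: (@compact_joint_near _ _ _ _ _ (fun h t => `|q0 t - q h t| <= e1)).
    exact: segment_compact.
  move=> x xcd; have abx := eoo_itv abc abd xcd.
  have e20 : 0 < e1 / 2 by rewrite divr_gt0.
  have H1 : \forall ht \near filter_prod F (nbhs x),
      `|q0 x - q ht.1 ht.2| < e1 / 2.
    exact: (cvgrPdist_lt _ _).1 (qq0 x abx) _ e20.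
  have H2 : \forall ht \near filter_prod F (nbhs x), `|q0 x - q0 ht.2| < e1 / 2.
    exists (setT, [set t | `|q0 x - q0 t| < e1 / 2]) => /=; last by move=> [h t] [].
    by split; [exact: filterT|exact: (cvgrPdist_lt _ _).1 (cq0 x abx) _ e20].
  apply: filterS2 H1 H2 => ht.
  rewrite !ltr_norml ler_norml; lra.
apply: filterS2 cq => h cqh le1.
have iq := eoo_integrable cqh abc abd; have iq0 := eoo_integrable cq0 abc abd.
rewrite -RintegralB//.
have iqq : mu.-integrable `[c, d] (EFin \o (fun t => q0 t - q h t)).
  by apply: eoo_integrable => // x abx; apply: continuousB; [exact: cq0|exact: cqh].
apply: (le_trans (le_normr_Rintegral _ iqq)) => //.
apply: (@le_trans _ _ (\int[mu]_(t in `[c, d]) e1)).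
  apply: le_Rintegral => //.
    apply: eoo_integrable => // x abx.
    by apply: cvg_norm; apply: cvgB; [exact: cq0|exact: cqh].
  by apply: eoo_integrable => // x abx; exact: cvg_cst.
rewrite Rintegral_cst// [X in fine X](lebesgue_measure_itv `[c, d]%R) /= lte_fin.
case: ifPn => _ /=; last by rewrite mulr0 ltW.
rewrite /e1 mulrAC ler_pdivrMr// ler_wpM2l//; lra.
Qed.

End Integral.

(** * Limits of approximate solutions of a linear boundary value problem *)

Section LinearBVP.
Context {R : realType} {k n : nat} {m : 'I_k -> nat}.
Variables (a b : \bar R) (l : bdata R m).
Hypothesis (n_gt0 : (0 < n)%N) (m_le : forall j, (m j <= n)%N).
Hypothesis abx : forall j, eoo a b (bd_x l j).
Hypothesis abc : eoo a b (bd_c l).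
Hypothesis abd : eoo a b (bd_d l).
Hypothesis cd : bd_c l < bd_d l.
Local Notation mu := (@lebesgue_measure R).

(** The functional [bop] read off a chain, with p in front of the integral so that linearity and
    limits concern the integral of the entry of index 0 alone. *)
Definition chain_bop (Z : nat -> R -> R) (j : 'I_k) (i : nat) : R :=
  Z i (bd_x l j) +
  if j.+1 == k then bd_p l * \int[mu]_(t in `[bd_c l, bd_d l]) Z 0%N t else 0.

Lemma bop_chain Z y (j : 'I_k) i : derivative_chain a b n Z -> 
  (forall x, eoo a b x -> y x = Z 0%N x) -> (i <= n)%N ->
  bop l y j i = chain_bop Z j i.
Proof.
move=> cZ yZ ni; rewrite /bop /chain_bop (chain_derive1n cZ yZ)//; congr (_ + _).
case: ifP => // _; rewrite -RintegralZl//; last first.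
  apply: (eoo_integrable (a := a) (b := b)) => // x abx'.
  exact: (chain_continuous cZ n_gt0 abx').
apply: eq_Rintegral => t; rewrite inE /= => tcd.
by rewrite yZ//; exact: (eoo_itv abc abd).
Qed.

Lemma chain_bop_lin Z Z' (r r' : R) j i :
  derivative_chain a b n Z -> derivative_chain a b n Z' ->
  chain_bop (fun i x => r * Z i x + r' * Z' i x) j i =
  r * chain_bop Z j i + r' * chain_bop Z' j i.
Proof.
move=> cZ cZ'; rewrite /chain_bop; case: ifP => _; last by ring.
have iZ Y : derivative_chain a b n Y ->
    mu.-integrable `[bd_c l, bd_d l] (EFin \o Y 0%N).
  move=> cY; apply: (eoo_integrable (a := a) (b := b)) => // x abx'.
  exact: (chain_continuous cY n_gt0 abx').
have iMZ Y s : derivative_chain a b n Y ->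
    mu.-integrable `[bd_c l, bd_d l] (EFin \o (fun t => s * Y 0%N t)).
  move=> cY; apply: (eoo_integrable (a := a) (b := b)) => // x abx'.
  by apply: continuousM; [exact: cvg_cst|exact: (chain_continuous cY)].
rewrite RintegralD//; [|exact: iMZ|exact: iMZ].
by rewrite !RintegralZl//; [ring|exact: iZ|exact: iZ].
Qed.

Lemma chain_lin Z Z' (r r' : R) :
  derivative_chain a b n Z -> derivative_chain a b n Z' ->
  derivative_chain a b n (fun i x => r * Z i x + r' * Z' i x).
Proof.
move=> cZ cZ' i ni x abx'.
have dZ := cZ i ni x abx'; have dZ' := cZ' i ni x abx'.
have -> : (fun x => r * Z i x + r' * Z' i x) = r \*: Z i + r' \*: Z' i.
  by apply/funext.
exact: is_derive_eq.
Qed.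

Lemma chain_bop_cvg (T : Type) (F : set_system T) {FF : ProperFilter F}
    (v : T -> nat -> R -> R) (V : nat -> R -> R) j i :
  (\forall h \near F, derivative_chain a b n (v h)) ->
  derivative_chain a b n V ->
  (forall i x, (i <= n)%N -> eoo a b x ->
    v ht.1 i ht.2 @[ht --> filter_prod F (nbhs x)] --> V i x) ->
  (i <= n)%N -> chain_bop (v h) j i @[h --> F] --> chain_bop V j i.
Proof.
move=> cv cV vV ni; rewrite /chain_bop; apply: cvgD.
  exact: (joint_cvg_pt (q := fun h => v h i) (vV i _ ni (abx j))).
case: ifP => _; last exact: cvg_cst.
apply: cvgM; first exact: cvg_cst.
apply: (integral_joint_cvg (q := fun h => v h 0%N) abc abd (ltW cd)).
- by apply: filterS cv => h ch x abx'; exact: (chain_continuous ch n_gt0 abx').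
- by move=> x abx'; exact: (chain_continuous cV n_gt0 abx').
- by move=> x; exact: vV.
Qed.

Variables (g : R -> 'rV[R]_n -> R) (A0 : 'I_n -> R -> R).
Hypothesis gE : forall x v, g x v = \sum_(i < n) A0 i x * v 0 i.
Hypothesis g_trivial : forall y, solves a b g y ->
  (forall j (i : 'I_(m j)), bop l y j i = 0) -> forall x, eoo a b x -> y x = 0.

Lemma linear_bvp_unique (w : forall j, 'I_(m j) -> R) z z' :
  solves_bvp a b g l w z -> solves_bvp a b g l w z' ->
  forall x, eoo a b x -> z x = z' x.
Proof.
move=> [sz wz] [sz' wz'] x abx'.
have cz := solves_chain sz; have cz' := solves_chain sz'.
apply/eqP; rewrite -subr_eq0; apply/eqP.
have cd' := chain_lin 1 (- 1) cz cz'.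
have -> : z x - z' x = 1 * z x + -1 * z' x by ring.
apply: (g_trivial (y := fun x => 1 * z x + -1 * z' x)) => //.
  apply: (chain_solves cd') => // t abt.
  rewrite (sz t abt).2 (sz' t abt).2 !gE !mulr_sumr -big_split /=.
  by apply: eq_bigr => i _; rewrite !mxE; ring.
move=> j i; have ni : (i <= n)%N by rewrite (leq_trans (ltnW (ltn_ord i))).
rewrite (bop_chain (y := fun x => 1 * z x + -1 * z' x) j cd')// chain_bop_lin//.
by rewrite -(bop_chain (y := z) j cz)// -(bop_chain (y := z') j cz')// wz wz'; ring.
Qed.

Section Limit.
Context {T : Type}.
Variables (Z : T -> nat -> R -> R) (A : T -> 'I_n -> R -> R).
Variable (w : forall j, 'I_(m j) -> R).

(** The functionals are those of the fixed tuple [l]; any dependence of the problem on [h] sits in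
    the coefficients and in the boundary values. No bound on [Z h] is demanded. *)
Definition approximates (F : set_system T) :=
  [/\ \forall h \near F, derivative_chain a b n (Z h),
      \forall h \near F, forall x, eoo a b x ->
        Z h n x = \sum_(i < n) A h i x * Z h i x,
      forall i x, eoo a b x ->
        A ht.1 i ht.2 @[ht --> filter_prod F (nbhs x)] --> A0 i x &
      forall j (i : 'I_(m j)), chain_bop (Z h) j i @[h --> F] --> w i].

Lemma approximatesS F G : approximates F -> F `<=` G -> approximates G.
Proof.
move=> [cZ Zn AA0 Zw] FG; split.
- exact: FG.
- exact: FG.
- move=> i x abx' B /(AA0 i x abx')[[P Q] /= [FP xQ] PQ].
  by exists (P, Q) => //; split => //; exact: FG.
- by move=> j i B /Zw; exact: FG.
Qed.

Lemma ultra_bvp_limit F : UltraFilter F -> approximates F ->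
  exists2 z, solves_bvp a b g l w z &
    forall x, eoo a b x -> Z h 0%N x @[h --> F] --> z x.
Proof.
move=> FU [cZ Zn AA0 Zw].
pose x0 := bd_c l.
(* The summand 1 confines the scaling factor [s h] to the interval from 0 to 1, so it has a limit
   along the ultrafilter. *)
pose N h := 1 + \sum_(i < n) `|Z h i x0|.
have N1 h : 1 <= N h by rewrite lerDl sumr_ge0.
have N0 h : 0 < N h by apply: lt_le_trans (N1 h).
pose s h := (N h)^-1.
have s0 h : 0 < s h by rewrite invr_gt0.
(* The term 0 * Z gives v the shape required by chain_lin. *)
pose v h i x := s h * Z h i x + 0 * Z h i x.
have vE h i x : v h i x = s h * Z h i x by rewrite /v mul0r addr0.
have cv : \forall h \near F, derivative_chain a b n (v h).
  by apply: filterS cZ => h ch; exact: chain_lin.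
have vn : \forall h \near F, forall x, eoo a b x ->
    v h n x = \sum_(i < n) A h i x * v h i x.
  apply: filterS Zn => h Zhn x /Zhn e; rewrite vE e mulr_sumr.
  by apply: eq_bigr => i _; rewrite vE; ring.
(* This normalisation survives in the limit and prevents the factors and the scaled chains from
   vanishing together. *)
have v_sum h : s h + \sum_(i < n) `|v h i x0| = 1.
  rewrite (eq_bigr (fun i : 'I_n => s h * `|Z h i x0|)).
    by rewrite -mulr_sumr -{1}(mulr1 (s h)) -mulrDr mulVf// gt_eqF.
  by move=> i _; rewrite vE normrM gtr0_norm.
have vb (i : 'I_n) : \forall h \near F, `|v h i x0| <= 1.
  apply: filterE => h; rewrite -(v_sum h) (bigD1 i)//= addrCA lerDl.
  by rewrite addr_ge0// ?sumr_ge0// ltW.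
have [V [cV Vn vV]] := chain_ultralimit abc cv vn AA0 vb.
have /cvg_ex[/= r sr] : cvg (s h @[h --> F]).
  apply: (ultra_bounded_cvg (M := 1) FU); apply: filterE => h.
  by rewrite gtr0_norm// invf_le1.
have r0 : 0 <= r by apply: (cvgr_to_ge sr); apply: filterE => h; exact: ltW.
have V_sum : r + \sum_(i < n) `|V i x0| = 1.
  have : s h + \sum_(i < n) `|v h i x0| @[h --> F] --> r + \sum_(i < n) `|V i x0|.
    apply: cvgD => //; apply: cvg_big => [|i _]; first exact: add_continuous.
    apply: cvg_norm.
    exact: (joint_cvg_pt (q := fun h => v h i) (vV i _ (ltnW (ltn_ord i)) abc)).
  under eq_cvg do rewrite v_sum.
  by move=> /(cvg_unique _)-/(_ (@norm_hausdorff _ _) _ (cvg_cst _)) <-.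
have Vsol : solves a b g (V 0%N).
  apply: (chain_solves cV) => // x /Vn ->; rewrite gE.
  by apply: eq_bigr => i _; rewrite mxE.
have Vbop j (i : 'I_(m j)) : chain_bop V j i = r * w i.
  have ni : (i <= n)%N by rewrite (leq_trans (ltnW (ltn_ord i))).
  have H1 : chain_bop (v h) j i @[h --> F] --> chain_bop V j i.
    exact: chain_bop_cvg.
  have H2 : chain_bop (v h) j i @[h --> F] --> r * w i.
    have : s h * chain_bop (Z h) j i @[h --> F] --> r * w i by exact: cvgM.
    apply: cvg_trans; apply: near_eq_cvg; apply: filterS cZ => h ch.
    by rewrite /v chain_bop_lin// mul0r addr0.
  exact: (cvg_unique _ H1 H2).
(* For [r = 0] all boundary values of [V] vanish, so [V 0] is zero on (a, b) and with it every entry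
   [V i] at [x0], against [V_sum]. *)
have r_gt0 : 0 < r.
  rewrite lt_neqAle r0 andbT; apply/eqP => r_eq0.
  have V0 x : eoo a b x -> V 0%N x = 0.
    apply: g_trivial => // j i; rewrite (bop_chain (y := V 0%N) j cV)//.
      by rewrite Vbop -r_eq0 mul0r.
    by rewrite (leq_trans (ltnW (ltn_ord i))).
  have c0 : derivative_chain a b n (fun _ => cst 0) by move=> *; exact: is_derive_cst.
  have /eqP := V_sum; rewrite -r_eq0 add0r big1 ?(eq_sym 0) ?oner_eq0// => i _.
  have ni := ltnW (ltn_ord i).
  rewrite -(chain_derive1n cV (fun _ _ => erefl))//.
  by rewrite (chain_derive1n c0)// normr0.
have cVr := chain_lin r^-1 0 cV cV.
exists (fun x => r^-1 * V 0%N x + 0 * V 0%N x).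
  split.
    apply: (chain_solves cVr) => // x abx'; rewrite gE Vn// mulr_sumr mul0r addr0.
    by apply: eq_bigr => i _; rewrite mxE; ring.
  move=> j i; have ni : (i <= n)%N by rewrite (leq_trans (ltnW (ltn_ord i))).
  rewrite (bop_chain (y := fun x => r^-1 * V 0%N x + 0 * V 0%N x) j cVr)//.
  by rewrite chain_bop_lin// Vbop mul0r addr0 mulKf// gt_eqF.
move=> x abx'; rewrite mul0r addr0.
have -> : (fun h => Z h 0%N x) = (fun h => (s h)^-1 * v h 0%N x).
  by apply/funext => h; rewrite vE mulKf// gt_eqF.
apply: cvgM; first by apply: cvgV => //; rewrite gt_eqF.
exact: (joint_cvg_pt (q := fun h => v h 0%N) (vV 0%N _ (leq0n n) abx')).
Qed.

(** One ultrafilter above [F] supplies [z]. Any other one yields a solution of the same problem,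
    equal to [z] by [linear_bvp_unique], so [ultra_cvg] gives convergence along [F] itself. *)
Lemma bvp_limit F : ProperFilter F -> approximates F ->
  exists2 z, solves_bvp a b g l w z &
    forall x, eoo a b x -> Z h 0%N x @[h --> F] --> z x.
Proof.
move=> FF aF; have [G [GU FG]] := ultraFilterLemma FF.
have [z zs _] := ultra_bvp_limit GU (approximatesS aF FG).
exists z => // x abx'; apply: ultra_cvg => H HU FH.
have [z' zs' zz'] := ultra_bvp_limit HU (approximatesS aF FH).
by rewrite (linear_bvp_unique zs zs' abx'); exact: zz'.
Qed.

End Limit.
End LinearBVP.

(** * Mean value theorems in several variables and for moving functions *)

Section MeanValue.
Context {R : realType}.

Lemma is_derive_line n (f : 'rV[R]_n -> R) (u e : 'rV[R]_n) (s : R) :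
  derivable f (s *: e + u) e ->
  is_derive s 1 (fun t => f (t *: e + u)) ('D_e f (s *: e + u)).
Proof.
move=> df.
have E : (fun h : R => h^-1 *: (((fun t => f (t *: e + u)) \o shift s) (h *: 1) -
      f (s *: e + u))) =
    (fun h => h^-1 *: ((f \o shift (s *: e + u)) (h *: e) - f (s *: e + u))).
  by apply/funext => h; rewrite /= addrA -scalerDl [h *: 1]mulr1.
by apply: DeriveDef; rewrite /derivable /derive E.
Qed.

(** One passes from [v] to [w] through the vectors [p r], whose first [r] coordinates are already
    those of [w]. Each step runs along a coordinate line, where the one-variable theorem applies,
    and the increments telescope. *)
Lemma mvt_rV n (f : 'rV[R]_n -> R) (v w : 'rV[R]_n) :
  (forall i u, derivable f u (delta_mx 0 i)) ->
  exists xi : 'I_n -> 'rV[R]_n,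
    (forall i j, `|v 0 j - xi i 0 j| <= `|v 0 j - w 0 j|) /\
    f w - f v = \sum_(i < n) 'D_(delta_mx 0 i) f (xi i) * (w 0 i - v 0 i).
Proof.
move=> df.
pose p (r : nat) : 'rV[R]_n := \row_j (if (j < r)%N then w 0 j else v 0 j).
have pS (i : 'I_n) : p i.+1 = (w 0 i - v 0 i) *: delta_mx 0 i + p i.
  apply/rowP => j; rewrite !mxE eqxx ltnS leq_eqVlt /=.
  have [->|ji] := eqVneq j i; first by rewrite eqxx ltnn /= mulr1 subrK.
  by rewrite (negbTE (ji : (j : nat) != i)) mulr0 add0r.
have step (i : 'I_n) : exists u : 'rV[R]_n,
    (forall j, `|v 0 j - u 0 j| <= `|v 0 j - w 0 j|) /\
    f (p i.+1) - f (p i) = 'D_(delta_mx 0 i) f u * (w 0 i - v 0 i).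
  have [c cx] := @MVT_between R (fun t => f (t *: delta_mx 0 i + p i))
    (fun t => 'D_(delta_mx 0 i) f (t *: delta_mx 0 i + p i)) 0 (w 0 i - v 0 i)
    (fun t _ => is_derive_line (df _ _)).
  rewrite scale0r add0r -pS subr0 => fE.
  exists (c *: delta_mx 0 i + p i); split=> // j.
  rewrite !mxE eqxx /=; have [->|ji] := eqVneq j i.
    rewrite ltnn mulr1 opprD addrCA subrr addr0 normrN.
    by have := between_dist cx; rewrite !sub0r !normrN (distrC (w 0 i)).
  by rewrite mulr0 add0r; case: ifP => //; rewrite subrr normr0.
have [xi xiP] := choice step.
exists xi; split=> [i|]; first exact: (xiP i).1.
have -> : f w - f v = \sum_(0 <= i < n) (f (p i.+1) - f (p i)).
  rewrite telescope_sumr//; congr (f _ - f _); apply/rowP => j; rewrite mxE ?ltn0//.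
  by rewrite ltn_ord.
by rewrite big_mkord; apply: eq_bigr => i _; rewrite (xiP i).2.
Qed.

Lemma rV_cvg (T : Type) (F : set_system T) {FF : Filter F} n
    (X : T -> 'rV[R]_n) (v : 'rV[R]_n) :
  (forall j, X t 0 j @[t --> F] --> v 0 j) -> X t @[t --> F] --> v.
Proof.
move=> Xv B [P vP PB].
have : \forall t \near F, forall j, P 0 j (X t 0 j).
  by apply: filter_forall => j; exact: (Xv j _ (vP 0 j)).
by apply: filterS => t Pt; apply: PB => i j; rewrite (ord1 i).
Qed.

(** The function changes together with the step. The quotient is [q h c] for some [c] within [|h|]
    of [x], and joint convergence allows [h] and [c] to vary at once. *)
Lemma diffquot_cvg (g q : R -> R -> R) (x l : R) :
  (\forall ht \near filter_prod (0 : R)^' (nbhs x),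
    is_derive (ht.2 : R) 1 (g ht.1) (q ht.1 ht.2)) ->
  q ht.1 ht.2 @[ht --> filter_prod (0 : R)^' (nbhs x)] --> l ->
  h^-1 * (g h (h + x) - g h x) @[h --> (0 : R)^'] --> l.
Proof.
move=> dg ql; apply/cvgrPdist_le => e e0.
have : \forall ht \near filter_prod (0 : R)^' (nbhs x),
    is_derive (ht.2 : R) 1 (g ht.1) (q ht.1 ht.2) /\ `|l - q ht.1 ht.2| <= e.
  by apply: filterS2 dg ((cvgrPdist_le _ _).1 ql e e0) => ht; split.
move=> /(joint_nearP
  (fun h t => is_derive t 1 (g h) (q h t) /\ `|l - q h t| <= e))[d d0 Fd].
near=> h.
have h0 : h != 0 by near: h; exact: nbhs_dnbhs_neq.
have hd : `|h| < d by near: h; exact: dnbhs0_lt.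
have Fh : forall t : R, `|x - t| < d ->
  is_derive t 1 (g h) (q h t) /\ `|l - q h t| <= e by near: h.
have dist c : Num.min x (h + x) <= c <= Num.max x (h + x) -> `|x - c| < d.
  move=> /between_dist/le_lt_trans; apply.
  by rewrite opprD addrCA subrr addr0 normrN.
have [c cx ->] : exists2 c, Num.min x (h + x) <= c <= Num.max x (h + x) &
    g h (h + x) - g h x = q h c * (h + x - x).
  by apply: MVT_between => c /dist/Fh[].
rewrite addrK mulrCA mulVf// mulr1.
by have [] := Fh c (dist c cx).
Unshelve. all: by end_near. Qed.

End MeanValue.

(** * The solution family along a line of boundary data *)

Lemma line_cvg {R : realType} (V : normedModType R) (e l : V) :
  h *: e + l @[h --> (0 : R)^'] --> l.
Proof.
rewrite -[X in _ --> X]add0r -(scale0r e).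
apply: cvgD; last exact: cvg_cst.
by apply: cvgZr_tmp; exact: nbhs_dnbhs.
Qed.

Section Family.
Context {R : realType} {k n : nat} {m : 'I_k -> nat}.
Variables (a b : \bar R) (f : R -> 'rV[R]_n -> R).
Variables (l0 : bdata R m) (N : set (bdata R m)) (U : bdata R m -> R -> R).
Hypothesis hU : solution_family a b f l0 N U.
Variable e : bdata R m.

(** The summands stand in the order of the difference quotient that defines ['D_e]. *)
Definition along (h : R) : bdata R m := h *: e + l0.

Lemma along_cvg : along h @[h --> (0 : R)^'] --> l0.
Proof.
exact: (@line_cvg R (bdata R m)).
Qed.

Lemma family_solves : \forall h \near (0 : R)^',
  solves_bvp a b f (along h) (@bd_y _ _ _ (along h)) (U (along h)).
Proof.
have [l0N Nsol _] := hU.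
have : \forall h \near (0 : R)^', N (along h) by exact: along_cvg.
by apply: filterS => h /Nsol.
Qed.

(** Uniform convergence on a compact neighbourhood of [x] combines with continuity of the limit at
    [x]. *)
Lemma family_cvg i x : (i < n)%N -> eoo a b x ->
  (U (along ht.1))^`(i)%classic ht.2 @[ht --> filter_prod (0 : R)^' (nbhs x)] -->
    (U l0)^`(i)%classic x.
Proof.
have [l0N Nsol Ucvg] := hU.
move=> ni abx; have /nbhs_ballP[d /= d0 dab] := eoo_near abx.
have d20 : 0 < d / 2 by rewrite divr_gt0.
have d2d : d / 2 < d by rewrite ltr_pdivrMr// ltr_pMr// ltr1n.
have [/andP[al _] /andP[_ be]] : eoo a b (x - d / 2) /\ eoo a b (x + d / 2).
  split; apply: dab; rewrite /ball /=.
    by rewrite opprB addrC subrK gtr0_norm.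
  by rewrite opprD addrA subrr sub0r normrN gtr0_norm.
have albe : x - d / 2 <= x + d / 2 by lra.
have {}Ucvg := Ucvg i _ _ ni al albe be.
apply/cvgrPdist_lt => r r0; have r20 : 0 < r / 2 by rewrite divr_gt0.
have U1 : \forall h \near (0 : R)^', forall t, `[x - d / 2, x + d / 2] t ->
    `|(U l0)^`(i)%classic t - (U (along h))^`(i)%classic t| < r / 2.
  have : nbhs l0 [set l | forall t, `[x - d / 2, x + d / 2] t ->
      `|(U l0)^`(i)%classic t - (U l)^`(i)%classic t| < r / 2].
    apply: (Ucvg [set g | forall t, `[x - d / 2, x + d / 2] t ->
      `|(U l0)^`(i)%classic t - g t| < r / 2]); apply/uniform_nbhs.
    exists [set st | ball st.1 (r / 2) st.2]; split=> //.
    exact: entourage_ball (PosNum r20).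
  exact: along_cvg.
have U2 : \forall t \near x, `|(U l0)^`(i)%classic x - (U l0)^`(i)%classic t| < r / 2.
  have := chain_continuous (solves_chain (Nsol l0 (nbhs_singleton l0N)).1) ni abx.
  by move=> /cvgrPdist_lt; exact.
have [d' /= d'0 U2'] := (nbhs_ballP _ _).1 U2.
apply/(joint_nearP (fun h t =>
  `|(U l0)^`(i)%classic x - (U (along h))^`(i)%classic t| < r)).
exists (Num.min (d / 2) d'); first by rewrite lt_min d20.
apply: filterS U1 => h Uh t; rewrite lt_min => /andP[xd xd'].
have := U2' t xd'.
have /Uh : `[x - d / 2, x + d / 2] t.
  by rewrite /= in_itv /=; move: xd; rewrite ltr_norml; lra.
rewrite !ltr_norml; lra.
Qed.

End Family.

(** * Reduction of a partial derivative to its boundary values *)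

Section PartialDerivative.
Context {R : realType} {k n : nat} {m : 'I_k -> nat}.
Variables (a b : \bar R) (f : R -> 'rV[R]_n -> R).
Variables (l0 : bdata R m) (N : set (bdata R m)) (U : bdata R m -> R -> R).
Hypothesis hU : solution_family a b f l0 N U.
Hypothesis (n_gt0 : (0 < n)%N) (m_le : forall j, (m j <= n)%N).
Hypothesis abx : forall j, eoo a b (bd_x l0 j).
Hypothesis abc : eoo a b (bd_c l0).
Hypothesis abd : eoo a b (bd_d l0).
Hypothesis cd : bd_c l0 < bd_d l0.
Hypothesis hdf : forall (i : 'I_n) x v, eoo a b x ->
  derivable (f x) v (delta_mx 0 i) /\
  {for (x, v), continuous (fun q : R * 'rV[R]_n => pderiv f i q.1 q.2)}.
Hypothesis hvar : forall z, solves a b (variational f (U l0)) z ->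
  (forall j (i : 'I_(m j)), bop l0 z j i = 0) -> forall x, eoo a b x -> z x = 0.

Lemma along_y e h (j : 'I_k) (i : 'I_(m j)) :
  bd_y (along l0 e h) i = h * bd_y e i + bd_y l0 i.
Proof. by rewrite /bd_y /along /= !mxE. Qed.

(** Since [u h] takes its own data under its own functional, the quotient [Z h] has exactly the
    boundary values displayed in the hypothesis. It remains for each direction to see how the
    functional changes between the two tuples while [u h] is kept. *)
Lemma partial_solves_of (e : bdata R m) (w : forall j, 'I_(m j) -> R) :
  (forall j (i : 'I_(m j)),
    h^-1 * (bop l0 (U (along l0 e h)) j i -
            bop (along l0 e h) (U (along l0 e h)) j i) + bd_y e i
      @[h --> (0 : R)^'] --> w j i) ->
  partial_solves a b f l0 U e w.
Proof.
move=> bop_w; have [l0N Nsol _] := hU.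
have [sol0 bop0] := Nsol l0 (nbhs_singleton l0N).
have ch0 := solves_chain sol0.
pose u h := U (along l0 e h).
have usol := family_solves hU e.
pose Z h i x := h^-1 * (u h)^`(i)%classic x + - h^-1 * (U l0)^`(i)%classic x.
(* The intermediate points are chosen for all arguments at once, so that the coefficients [A h i t]
   become functions; outside (a, b) the choice is arbitrary. *)
have /choice[xi xiP] : forall tvw : R * 'rV[R]_n * 'rV[R]_n,
    exists xi : 'I_n -> 'rV[R]_n, eoo a b tvw.1.1 ->
    (forall i j, `|tvw.1.2 0 j - xi i 0 j| <= `|tvw.1.2 0 j - tvw.2 0 j|) /\
    f tvw.1.1 tvw.2 - f tvw.1.1 tvw.1.2 =
      \sum_(i < n) pderiv f i tvw.1.1 (xi i) * (tvw.2 0 i - tvw.1.2 0 i).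
  move=> [[t v] v'] /=; have [abt|nabt] := pselect (eoo a b t); last first.
    by exists (fun=> v).
  by have [xi xiP] := mvt_rV v v' (fun i y => (hdf i y abt).1); exists xi.
pose X h t := xi (t, jet (U l0) t, jet (u h) t).
pose A h i t := pderiv f i t (X h t i).
have aprx : approximates a b l0 (fun i x => pderiv f i x (jet (U l0) x)) Z A w (0 : R)^'.
  split.
  - by apply: filterS usol => h [/solves_chain ch _]; exact: chain_lin.
  - apply: filterS usol => h [sh _] x abx'.
    rewrite /Z (sh x abx').2 (sol0 x abx').2 mulNr -mulrBr.
    have [_ ->] := xiP (x, jet (U l0) x, jet (u h) x) abx'.
    rewrite mulr_sumr; apply: eq_bigr => i _; rewrite !mxE /A /X; ring.
  - move=> i x abx'.
    have cX : X ht.1 ht.2 i @[ht --> filter_prod (0 : R)^' (nbhs x)] -->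
        jet (U l0) x.
      apply: rV_cvg => j; rewrite mxE; apply/cvgrPdist_lt => r r0.
      (* At [t] the intermediate point lies within 2r/3 of the jet of [U l0], being no farther from
         it than the jet of [u h]; moving from [t] to [x] costs another r/3. *)
      have r30 : 0 < r / 3 by rewrite divr_gt0.
      have H1 : \forall ht \near filter_prod (0 : R)^' (nbhs x),
          `|(U l0)^`(j)%classic x - (u ht.1)^`(j)%classic ht.2| < r / 3.
        exact: (cvgrPdist_lt _ _).1 (family_cvg hU e (ltn_ord j) abx') _ r30.
      have H2 : \forall ht \near filter_prod (0 : R)^' (nbhs x), eoo a b ht.2 /\
          `|(U l0)^`(j)%classic x - (U l0)^`(j)%classic ht.2| < r / 3.
        have cU := chain_continuous ch0 (ltn_ord j) abx'.
        have H : \forall t \near x,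
            `|(U l0)^`(j)%classic x - (U l0)^`(j)%classic t| < r / 3.
          exact: (cvgrPdist_lt _ _).1 cU _ r30.
        have HI : \forall t \near x, eoo a b t /\
            `|(U l0)^`(j)%classic x - (U l0)^`(j)%classic t| < r / 3.
          by apply: filterS2 (eoo_near abx') H => t; split.
        exact: (joint_near_snd (P := fun t => eoo a b t /\
          `|(U l0)^`(j)%classic x - (U l0)^`(j)%classic t| < r / 3)).
      apply: filterS2 H1 H2 => ht H1 [abt H2].
      have [/(_ i j) + _] := xiP (ht.2, jet (U l0) ht.2, jet (u ht.1) ht.2) abt.
      rewrite /X /= !mxE => H3.
      move: H1 H2 H3; set y1 := xi _ _ _ _.
      set y2 := (U l0)^`(j)%classic _; set y3 := _ ht.2; set y4 := _ ht.2.
      move=> H1 H2 H3; have H4 : `|y4 - y3| < r / 3 + r / 3.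
        by move: H1 H2; rewrite !ltr_norml; lra.
      by have := le_lt_trans H3 H4; move: H2; rewrite !ltr_norml; lra.
    have c2 : ht.2 @[ht --> filter_prod (0 : R)^' (nbhs x)] --> x by exact: cvg_snd.
    exact: (cvg_comp _ _ (cvg_pair c2 cX) (hdf i _ abx').2).
  - move=> j i; have ni : (i <= n)%N by rewrite (leq_trans (ltnW (ltn_ord i))).
    apply: cvg_trans (bop_w j i); apply: near_eq_cvg.
    near=> h; have h0 : h != 0 by near: h; exact: nbhs_dnbhs_neq.
    have [sh bh] : solves_bvp a b f (along l0 e h) (@bd_y _ _ _ (along l0 e h)) (u h).
      by near: h.
    have chh := solves_chain sh.
    have E0 : bop l0 (u h) j i = chain_bop l0 (fun i => (u h)^`(i)%classic) j i.
      exact: (bop_chain n_gt0 abx abc abd).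
    have E1 : bop l0 (U l0) j i = chain_bop l0 (fun i => (U l0)^`(i)%classic) j i.
      exact: (bop_chain n_gt0 abx abc abd).
    rewrite /Z (chain_bop_lin n_gt0 abc abd)// -E0 -E1 bop0 bh along_y.
    by field.
have [z zs Zz] : exists2 z, solves_bvp a b (variational f (U l0)) l0 w z &
    forall x, eoo a b x -> Z h 0%N x @[h --> (0 : R)^'] --> z x.
  by apply: bvp_limit aprx.
have Dz x : eoo a b x ->
    h^-1 *: (((fun l => U l x) \o shift l0) (h *: e) - U l0 x) @[h --> (0 : R)^'] --> z x.
  move=> /Zz; apply: cvg_trans; apply: near_eq_cvg; apply: filterE => h.
  by rewrite /Z /u /along /= mulNr -mulrBr.
have DE x : eoo a b x -> 'D_e (fun l => U l x) l0 = z x.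
  by move=> /Dz zx; apply/cvg_lim.
split; first by move=> x /Dz zx; apply/cvg_ex; exists (z x).
have [sz bz] := zs; have chz := solves_chain sz.
(* The partial derivative is known to equal [z] only on (a, b), so its derivatives are read off the
   chain of [z]. *)
have Dsol : solves_bvp a b (variational f (U l0)) l0 w
    (fun x => 'D_e (fun l => U l x) l0).
  split.
    apply: (chain_solves chz) => // x abx'.
    by rewrite (sz x abx').2.
  move=> j i; have ni : (i <= n)%N by rewrite (leq_trans (ltnW (ltn_ord i))).
  rewrite (bop_chain n_gt0 abx abc abd j chz)//.
  by rewrite -(bop_chain (y := z) n_gt0 abx abc abd j chz).
split=> // z' sz' x abx'.
exact: (linear_bvp_unique n_gt0 m_le abx abc abd (fun _ _ => erefl) hvar sz' Dsol).
Unshelve. all: by end_near. Qed.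

End PartialDerivative.

(** * Entries of the data along the coordinate directions *)

Section AlongDirection.
Context {R : realType} {k : nat} {m : 'I_k -> nat}.
Implicit Types (l e : bdata R m) (h : R).

Lemma along_x l e h j : bd_x (along l e h) j = h * bd_x e j + bd_x l j.
Proof. by rewrite /bd_x /along /= !mxE. Qed.

Lemma along_p l e h : bd_p (along l e h) = h * bd_p e + bd_p l.
Proof. by []. Qed.

Lemma along_c l e h : bd_c (along l e h) = h * bd_c e + bd_c l.
Proof. by []. Qed.

Lemma along_d l e h : bd_d (along l e h) = h * bd_d e + bd_d l.
Proof. by []. Qed.

Lemma dir_pE (j : 'I_k) (i : 'I_(m j)) (e := dir_p : bdata R m) :
  (bd_x e j = 0) * (bd_y e i = 0) *
  (bd_p e = 1) * (bd_c e = 0) * (bd_d e = 0).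
Proof. by rewrite /bd_x /bd_y /= !mxE. Qed.

Lemma dir_cE (j : 'I_k) (i : 'I_(m j)) (e := dir_c : bdata R m) :
  (bd_x e j = 0) * (bd_y e i = 0) *
  (bd_p e = 0) * (bd_c e = 1) * (bd_d e = 0).
Proof. by rewrite /bd_x /bd_y /= !mxE. Qed.

Lemma dir_dE (j : 'I_k) (i : 'I_(m j)) (e := dir_d : bdata R m) :
  (bd_x e j = 0) * (bd_y e i = 0) *
  (bd_p e = 0) * (bd_c e = 0) * (bd_d e = 1).
Proof. by rewrite /bd_x /bd_y /= !mxE. Qed.

Definition alongE := (along_x, along_p, along_c, along_d).

End AlongDirection.

(** * Limits of the quotients that arise from moving the data *)

Section Quotients.
Context {R : realType} {k n : nat} {m : 'I_k -> nat}.
Variables (a b : \bar R) (f : R -> 'rV[R]_n -> R).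
Variables (l0 : bdata R m) (N : set (bdata R m)) (U : bdata R m -> R -> R).
Hypothesis hU : solution_family a b f l0 N U.
Hypothesis n_gt0 : (0 < n)%N.
Variable e : bdata R m.
Local Notation mu := (@lebesgue_measure R).
Local Notation u h := (U (along l0 e h)).

Lemma solves_continuous y x : solves a b f y -> eoo a b x -> {for x, continuous y}.
Proof. by move=> /solves_chain cy abx; exact: (chain_continuous cy n_gt0 abx). Qed.

Lemma solves_integralZ y r s t : solves a b f y -> eoo a b s -> eoo a b t ->
  \int[mu]_(x in `[s, t]) (r * y x) = r * \int[mu]_(x in `[s, t]) y x.
Proof.
move=> sy abs abt; rewrite RintegralZl//.
by apply: (eoo_integrable (a := a) (b := b)) => // x; exact: solves_continuous.
Qed.

(** For a moving point x_l. The bound on [i] is there because the family converges only together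
    with its derivatives of order below [n]. *)
Lemma family_diffquot i x : (i.+1 < n)%N -> eoo a b x ->
  h^-1 * ((u h)^`(i)%classic (h + x) - (u h)^`(i)%classic x) @[h --> (0 : R)^'] -->
    (U l0)^`(i.+1)%classic x.
Proof.
move=> ni abx.
apply: (diffquot_cvg (g := fun h => (u h)^`(i)%classic)
  (q := fun h => (u h)^`(i.+1)%classic)).
  have [d d0 xab] := (nbhs_ballP _ _).1 (eoo_near abx).
  apply/(joint_nearP (fun h t =>
    is_derive t 1 (u h)^`(i)%classic ((u h)^`(i.+1)%classic t))).
  exists d => //; apply: filterS (family_solves hU e) => h [/solves_chain ch _] t xt.
  by apply: (ch i (ltnW ni)); exact: xab.
exact: (family_cvg hU e ni abx).
Qed.

(** For a moving end point c or d: the integral, as a function of its upper end, has derivative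
    [u h]. *)
Lemma family_integral_diffquot s x : eoo a b s -> eoo a b x -> s < x ->
  h^-1 * (\int[mu]_(t in `[s, h + x]) u h t - \int[mu]_(t in `[s, x]) u h t)
    @[h --> (0 : R)^'] --> U l0 x.
Proof.
move=> abs abx sx.
apply: (diffquot_cvg (g := fun h y => \int[mu]_(t in `[s, y]) u h t)
  (q := fun h => u h)); last exact: (family_cvg hU e n_gt0 abx).
have [d /= d0 xab] := (nbhs_ballP _ _).1 (eoo_near abx).
apply/(joint_nearP (fun h t =>
  is_derive t 1 (fun y => \int[mu]_(t in `[s, y]) u h t) (u h t))).
(* The second radius keeps the upper end point to the right of [s]. *)
exists (Num.min d (x - s)); first by rewrite lt_min d0 subr_gt0.
apply: filterS (family_solves hU e) => h [sh _] t.
rewrite lt_min => /andP[xt xst]; apply: (is_derive_integral _ abs).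
- by move=> y; exact: solves_continuous.
- exact: xab.
- by move: xst; rewrite ltr_norml; lra.
Qed.

Lemma family_integral_cvg c d : eoo a b c -> eoo a b d -> c <= d ->
  \int[mu]_(t in `[c, d]) u h t @[h --> (0 : R)^'] -->
    \int[mu]_(t in `[c, d]) U l0 t.
Proof.
move=> abc abd cd; have [l0N Nsol _] := hU.
apply: (integral_joint_cvg (q := fun h => u h) abc abd cd).
- apply: filterS (family_solves hU e) => h [sh _] x; exact: solves_continuous.
- by move=> x; apply: solves_continuous; exact: (Nsol l0 (nbhs_singleton l0N)).1.
- by move=> x abx; exact: (family_cvg hU e n_gt0 abx).
Qed.

End Quotients.

(** * The partial derivatives with respect to each kind of boundary data *)

Theorem theorem3p1 (R : realType) (k n : nat) (m : 'I_k -> nat)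
    (a b : \bar R) (f : R -> 'rV[R]_n -> R)
    (l0 : bdata R m) (N : set (bdata R m)) (U : bdata R m -> R -> R)
    (hkn : (2 <= k <= n)%N)
    (hm : forall j, (0 < m j)%N)
    (hmn : (\sum_(j < k) m j)%N = n)
    (hax : forall j, (a < (bd_x l0 j)%:E)%E)
    (hxx : forall i j : 'I_k, (i < j)%N -> bd_x l0 i < bd_x l0 j)
    (hxc : forall j, bd_x l0 j < bd_c l0)
    (hcd : bd_c l0 < bd_d l0)
    (hdb : ((bd_d l0)%:E < b)%E)
    (hf : forall x v, eoo a b x ->
       {for (x, v), continuous (fun q : R * 'rV[R]_n => f q.1 q.2)})
    (hdf : forall (i : 'I_n) x v, eoo a b x ->
       derivable (f x) v (delta_mx 0 i) /\
       {for (x, v), continuous (fun q : R * 'rV[R]_n => pderiv f i q.1 q.2)})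
    (hext : solutions_extend a b f)
    (huniq : forall y z, solves a b f y -> solves a b f z ->
       (forall j (i : 'I_(m j)), bop l0 y j i = bop l0 z j i) ->
       forall x, eoo a b x -> y x = z x)
    (hvar : forall y, solves a b f y ->
       forall w, solves a b (variational f y) w ->
       (forall j (i : 'I_(m j)), bop l0 w j i = 0) ->
       forall x, eoo a b x -> w x = 0)
    (hU : solution_family a b f l0 N U) :
  [/\
    (forall (l : 'I_k) (r : 'I_(m l)),
       partial_solves a b f l0 U (dir_y r)
         (fun j i => if (j == l) && (i == r :> nat) then 1 else 0)),
    (forall l : 'I_k,
       partial_solves a b f l0 U (dir_x l)
         (fun j i => if j == l then - ((U l0)^`(i.+1))%classic (bd_x l0 l) else 0)),
    partial_solves a b f l0 U dir_c
      (fun j i => if j.+1 == k then bd_p l0 * U l0 (bd_c l0) else 0),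
    partial_solves a b f l0 U dir_d
      (fun j i => if j.+1 == k then - (bd_p l0 * U l0 (bd_d l0)) else 0) &
    partial_solves a b f l0 U dir_p
      (fun j i => if j.+1 == k
         then - (\int[lebesgue_measure]_(t in `[bd_c l0, bd_d l0]) U l0 t)
         else 0)].
Proof.
pose mu := @lebesgue_measure R.
have [k2 kn] := andP hkn.
have n_gt0 : (0 < n)%N by rewrite (leq_trans _ kn)// ltnW.
(* There are at least two points, each with at least one condition. Strictness makes [i.+1 < n] for
   every order [i] prescribed at a point, as [family_diffquot] requires. *)
have m_lt j : (m j < n)%N.
  have [j' jj'] : exists j' : 'I_k, j' != j.
    have k0 : (0 < k)%N by exact: ltnW.
    have [j0|j0] := eqVneq (j : nat) 0%N.
      by exists (Ordinal k2); apply/eqP => /(congr1 val) /=; rewrite j0.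
    by exists (Ordinal k0); apply/eqP => /(congr1 val) /= /esym/eqP; exact/negP.
  rewrite -hmn (bigD1 j)//= (bigD1 j')//= -[X in (X < _)%N]addn0 ltn_add2l.
  by rewrite addn_gt0 hm.
have m_le j : (m j <= n)%N by exact: ltnW.
have abx j : eoo a b (bd_x l0 j).
  apply/andP; split=> //; apply: lt_trans hdb; rewrite lte_fin.
  exact: lt_trans (hxc j) hcd.
pose j0 : 'I_k := Ordinal (ltnW k2).
have abc : eoo a b (bd_c l0).
  apply/andP; split; last by apply: lt_trans hdb; rewrite lte_fin.
  by apply: lt_trans (hax j0) _; rewrite lte_fin.
have abd : eoo a b (bd_d l0).
  apply/andP; split=> //.
  by apply: lt_trans (hax j0) _; rewrite lte_fin (lt_trans (hxc j0)).
have hvar0 : forall z, solves a b (variational f (U l0)) z ->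
    (forall j (i : 'I_(m j)), bop l0 z j i = 0) -> forall x, eoo a b x -> z x = 0.
  by apply: hvar; case: hU => l0N /(_ l0 (nbhs_singleton l0N))[].
have reduce := partial_solves_of hU n_gt0 m_le abx abc abd hcd hdf hvar0.
have sol := family_solves hU.
have intZ := solves_integralZ (a := a) (b := b) (f := f) n_gt0.
split=> [l r|l|||]; apply: reduce => j i.
(* The functional does not depend on the y_ij, so its quotient is 0 and only the entry of the
   direction remains. *)
- have -> : bd_y (dir_y r) i =
      (if (j == l) && (i == r :> nat) then 1 else 0 : R).
    by rewrite /bd_y /= mxE eqxx /= -val_eqE /= tagnat.eq_Rank; case: ifP.
  under eq_cvg do rewrite /bop !alongE /bd_x /bd_p /bd_c /bd_d /= mxE !mulr0
    !add0r subrr mulr0 add0r.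
  exact: cvg_cst.
(* The integral terms cancel. What is left at x_l is minus a difference quotient of the derivative
   of order [i] of the varied solution. *)
- have -> : bd_y (dir_x l) i = 0 :> R by rewrite /bd_y /= mxE.
  have [jl|jl] := eqVneq j l; last first.
    under eq_cvg do rewrite addr0 /bop !alongE /bd_p /bd_c /bd_d /= !mulr0 !add0r
      [bd_x (dir_x l) j]mxE /= (negbTE jl) mulr0 add0r subrr mulr0.
    exact: cvg_cst.
  subst j; under eq_cvg do rewrite addr0 /bop !alongE /bd_p /bd_c /bd_d /= !mulr0
    !add0r [bd_x (dir_x l) l]mxE /= eqxx mulr1 opprD addrACA subrr addr0 -opprB mulrN.
  apply: cvgN; apply: (family_diffquot hU) => //.
  exact: leq_ltn_trans (ltn_ord i) (m_lt l).
- case: ifP => jk; last first.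
    under eq_cvg do rewrite /bop !alongE jk !(dir_cE i) mulr0 add0r subrr mulr0 addr0.
    exact: cvg_cst.
  (* The point [bd_x l0 j] lies to the left of c and serves as a fixed lower end. Raising c shortens
     the integral, which is why no minus sign appears. *)
  have lim_c : bd_p l0 * (h^-1 *
        (\int[mu]_(t in `[bd_x l0 j, h + bd_c l0]) U (along l0 dir_c h) t -
         \int[mu]_(t in `[bd_x l0 j, bd_c l0]) U (along l0 dir_c h) t))
      @[h --> (0 : R)^'] --> bd_p l0 * U l0 (bd_c l0).
    apply: cvgM; first exact: cvg_cst.
    exact: (family_integral_diffquot hU).
  apply: cvg_trans lim_c; apply: near_eq_cvg; near=> h.
  have [sh _] : solves_bvp a b f (along l0 dir_c h)
    (@bd_y _ _ _ (along l0 dir_c h)) (U (along l0 dir_c h)) by near: h.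
  (* For such [h] the moved end point stays between x_k and d, as the splitting of the integral
     demands. *)
  have hlt : `|h| < Num.min (bd_c l0 - bd_x l0 j) (bd_d l0 - bd_c l0).
    by near: h; apply: dnbhs0_lt; rewrite lt_min !subr_gt0 hxc hcd.
  have [xc cd'] : bd_x l0 j <= h + bd_c l0 /\ h + bd_c l0 <= bd_d l0.
    by move: hlt; rewrite lt_min !ltr_norml; lra.
  have abhc : eoo a b (h + bd_c l0).
    by apply: (eoo_itv (abx j) abd); rewrite in_itv /= xc.
  rewrite /bop !alongE jk !(dir_cE i) !mulr0 !add0r mulr1 addr0 !intZ//.
  have cu x : eoo a b x -> {for x, continuous (U (along l0 dir_c h))}.
    exact: (solves_continuous n_gt0 sh).
  rewrite (integral_diff cu (abx j) abd (ltW (hxc j)) (ltW hcd)).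
  rewrite (integral_diff cu (abx j) abd xc cd'); ring.
- case: ifP => jk; last first.
    under eq_cvg do rewrite /bop !alongE jk !(dir_dE i) mulr0 add0r subrr mulr0 addr0.
    exact: cvg_cst.
  (* Here the fixed lower end is c itself, and raising d lengthens the integral, whence the minus
     sign. *)
  have lim_d : - (bd_p l0 * (h^-1 *
        (\int[mu]_(t in `[bd_c l0, h + bd_d l0]) U (along l0 dir_d h) t -
         \int[mu]_(t in `[bd_c l0, bd_d l0]) U (along l0 dir_d h) t)))
      @[h --> (0 : R)^'] --> - (bd_p l0 * U l0 (bd_d l0)).
    apply: cvgN; apply: cvgM; first exact: cvg_cst.
    exact: (family_integral_diffquot hU).
  have [r /= r0 rab] := (nbhs_ballP _ _).1 (eoo_near abd).
  apply: cvg_trans lim_d; apply: near_eq_cvg; near=> h.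
  have [sh _] : solves_bvp a b f (along l0 dir_d h)
    (@bd_y _ _ _ (along l0 dir_d h)) (U (along l0 dir_d h)) by near: h.
  have abhd : eoo a b (h + bd_d l0).
    apply: rab; rewrite /ball /= opprD addrCA subrr addr0 normrN.
    by near: h; exact: dnbhs0_lt.
  rewrite /bop !alongE jk !(dir_dE i) !mulr0 !add0r mulr1 addr0 !intZ//; ring.
- case: ifP => jk; last first.
    under eq_cvg do rewrite /bop !alongE jk !(dir_pE i) mulr0 add0r subrr mulr0 addr0.
    exact: cvg_cst.
  (* The functional is affine in p, so for nonzero [h] its quotient equals minus the integral of the
     varied solution. *)
  have lim_p : - (\int[mu]_(t in `[bd_c l0, bd_d l0]) U (along l0 dir_p h) t)
      @[h --> (0 : R)^'] --> - (\int[mu]_(t in `[bd_c l0, bd_d l0]) U l0 t).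
    by apply: cvgN; apply: (family_integral_cvg hU) => //; exact: ltW.
  apply: cvg_trans lim_p; apply: near_eq_cvg; near=> h.
  have h0 : h != 0 by near: h; exact: nbhs_dnbhs_neq.
  have [sh _] : solves_bvp a b f (along l0 dir_p h)
    (@bd_y _ _ _ (along l0 dir_p h)) (U (along l0 dir_p h)) by near: h.
  rewrite /bop !alongE jk !(dir_pE i) !mulr0 !add0r mulr1 addr0 !intZ//; field.
Unshelve. all: by end_near. Qed.
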